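(* Let $X$ be an infinite zero-dimensional metrizable space. (1) If $X$ is Polish, then $X$ is weakly homeomorphic to one of the 3 spaces: $\omega$, $2^\omega$, $\mathbb N^\omega$. (2) If $X$ is $\sigma$-compact, then $X$ is weakly homeomorphic to one of the 5 spaces: $\omega$, $2^\omega$, $\mathbb Q$, $\mathbb Q\oplus 2^\omega$, $\mathbb Q\times 2^\omega$. (3) If $X$ is $\sigma$-Polish, then $X$ is weakly homeomorphic to one of the 9 spaces: $\omega$, $2^\omega$, $\mathbb N^\omega$, $\mathbb Q$, $\mathbb Q\oplus 2^\omega$, $\mathbb Q\oplus\mathbb N^\omega$, $\mathbb Q\times 2^\omega$, $(\mathbb Q\times 2^\omega)\oplus\mathbb N^\omega$, $\mathbb Q\times\mathbb N^\omega$.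
   Context: A map $f:X\to Y$ between topological spaces (not necessarily continuous) is weakly discontinuous if each subspace $A\subset X$ contains a relatively open dense subset $U\subset A$ such that the restriction $f|U$ is continuous. A weak homeomorphism is a bijective map $f$ such that both $f$ and $f^{-1}$ are weakly discontinuous; two spaces are weakly homeomorphic if there is a weak homeomorphism between them. A space is Polish if it is separable and its topology is generated by a complete metric. A space $X$ is $\sigma$-Polish if $X=\bigcup_{n\in\omega}X_n$ for some closed Polish subspaces $X_n$ of $X$; it is $\sigma$-compact if it is a countable union of compact subsets. A space is zero-dimensional if it has a base of its topology consisting of open-and-closed sets. Here $\omega$ is the set of non-negative integers with the discrete topology, $\mathbb N$ is the discrete space of positive integers, $2=\{0,1\}$ is discrete, $2^\omega$ and $\mathbb N^\omega$ carry the product topology, $\mathbb Q$ is the space of rational numbers with its usual topology, and $\oplus$ denotes the topological sum (disjoint union). *)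

(* Defs.v *)
From HB Require Import structures.
From mathcomp Require Import all_boot all_order all_algebra.
From mathcomp Require Import all_classical all_reals all_analysis.

Set Implicit Arguments.
Unset Strict Implicit.
Unset Printing Implicit Defensive.

Import Order.TTheory GRing.Theory Num.Theory.
Import numFieldNormedType.Exports.

Local Open Scope classical_set_scope.
Local Open Scope ring_scope.

(* The relatively open subsets of A are the sets A `&` V with V open in X, and
   A `&` V is dense in the subspace A iff A `<=` closure (A `&` V). *)
Definition weakly_discontinuous (X Y : topologicalType) (f : X -> Y) : Prop :=
  forall A : set X, exists V : set X,
    [/\ open V, A `<=` closure (A `&` V) & {within A `&` V, continuous f}].

Definition weakly_homeomorphic (X Y : topologicalType) : Prop :=
  exists (f : X -> Y) (g : Y -> X),
    [/\ cancel f g, cancel g f, weakly_discontinuous f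
      & weakly_discontinuous g].

Section metrizability.
Context (R : realType) (X : topologicalType).

Definition is_metric (d : X -> X -> R) : Prop :=
  [/\ forall x y, 0 <= d x y,
      forall x y, d x y = 0 <-> x = y,
      forall x y, d x y = d y x
    & forall x y z, d x z <= d x y + d y z].

Definition generates_topology (d : X -> X -> R) : Prop :=
  forall A : set X, open A <->
    (forall x, A x -> exists2 e : R, 0 < e & [set y | d x y < e] `<=` A).

Definition complete_metric (d : X -> X -> R) : Prop :=
  forall u : nat -> X,
    (forall e : R, 0 < e -> exists N : nat, forall m n : nat,
       (N <= m)%N -> (N <= n)%N -> d (u m) (u n) < e) ->
    exists l : X, forall e : R, 0 < e -> exists N : nat, forall n : nat,
      (N <= n)%N -> d (u n) l < e.

Definition metrizable : Prop :=
  exists d : X -> X -> R, is_metric d /\ generates_topology d.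

Definition separable : Prop := exists2 D : set X, countable D & dense D.

Definition polish : Prop :=
  separable /\
  exists d : X -> X -> R,
    [/\ is_metric d, generates_topology d & complete_metric d].

End metrizability.

(* As a type, F n : set X carries the subspace topology (the initial topology of
   its inclusion in X); this is not the library's [subspace (F n)].  The empty
   space counts as Polish. *)
Definition sigma_polish (R : realType) (X : topologicalType) : Prop :=
  exists F : nat -> set X,
    [/\ forall n, closed (F n),
        forall n, polish R (set_type (F n))
      & \bigcup_n F n = [set: X]].

Definition sigma_compact (X : topologicalType) : Prop :=
  exists2 K : nat -> set X, forall n, compact (K n) & \bigcup_n K n = [set: X].

(* The library's [zero_dimensional] only asks that distinct points be separated
   by a clopen set, which is weaker for metrizable spaces. *)
Definition has_clopen_basis (X : topologicalType) : Prop :=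
  exists2 B : set (set X), basis B & B `<=` clopen.

Definition topsum (X Y : topologicalType) : topologicalType :=
  {b : bool & Topological.sort (if b then X else Y)}.

(* The positive integers are replaced by nat: both are countably infinite
   discrete spaces. *)
Definition baire_space : topologicalType := prod_topology (fun _ : nat => nat).

(* rat^o carries the topology of the distance `|x - y|. *)
Definition rat_space : topologicalType := rat^o.

(* Main.v *)
From HB Require Import structures.
Require Import Defs.
From mathcomp Require Import all_boot all_order all_algebra.
From mathcomp Require Import all_classical all_reals all_analysis.

Set Implicit Arguments.
Unset Strict Implicit.
Unset Printing Implicit Defensive.

Import Order.TTheory GRing.Theory Num.Theory.
Import numFieldNormedType.Exports.

Local Open Scope classical_set_scope.

(** Everything is transported to subsets of the Cantor space.  A separable
metrizable space X with a clopen basis embeds in it, and the hypotheses become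
Borel classes of the image E: complete metrizability makes E a G_delta,
sigma-compactness makes it an F_sigma, and a countable closed cover by Polish
subspaces makes it the intersection of an F_sigma and a G_delta.

Weak homeomorphisms enter in two ways.
- A partition of a space into two resolvable pieces (sets S such that every
  nonempty D has a nonempty relatively open part inside S or outside S) may be
  replaced by the topological sum of the pieces.
- The Cantor-Bernstein bijection built from closed embeddings f : A -> B and
  g : B -> A is a weak homeomorphism (weakly_homeo_closed_embedding).  The
  alternating images A, g(B), g(f(A)), ... decrease and are closed, so a
  nonempty set not contained in all of them has a nonempty relatively open part
  between two consecutive ones, where the bijection is f or the inverse of g.
  So two spaces which embed in each other as closed subsets are weakly
  homeomorphic, and it suffices to construct closed embeddings in both
  directions between E and its model.

The space of rationals is represented by the set eventually_true of binary
sequences with finitely many zeros.  For the upper bounds, E embeds as a closed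
subset in the relevant model: the code of a point records, at each level,
whether the point still looks as if it were in the closed piece that is being
tracked, and a point of the closure is in the union of the pieces when this
fails only finitely often.

For the lower bounds one needs closed copies of the model in E.  Given a class C
of small sets (the empty set, the countable sets, the F_sigma sets), call E
thick for C if some nonempty relatively closed part of E is nowhere small and
nowhere G_delta.  Then a tree of cylinders can be built in E in which a node has
two kinds of children: those which keep tracking a given closed piece of E, and
those which avoid more and more of the closed pieces.  Branches with finitely
many children of the second kind have a limit in E and the others have none, so
the limits form a closed copy of the rationals, of the product of the rationals
with the Cantor space, or of their product with the Baire space (lemma scheme).
The same tree without children of the second kind yields closed copies of the
Cantor space and of the Baire space.

If E is not thick for C, then the union of all cylinders on which E splits into
a small part and a G_delta part is everything (lemma decomposition), so that E
is up to weak homeomorphism the sum of a member of C and a Polish space.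
Applying this to the three classes in turn leads to the nine cases; those which
involve the Baire space only occur when E is not an F_sigma. *)

(** * Weakly discontinuous maps on subsets *)

Definition continuous_on (X Y : topologicalType) (A : set X) (f : X -> Y) :
  Prop :=
  forall x, A x -> forall V, nbhs (f x) V -> nbhs x [set y | A y -> V (f y)].

(** A nonempty relatively open set of continuity in every nonempty subset
already gives a dense one, see weakly_disc_weakly_discontinuous, and this
pointwise form is easier to compose. *)
Definition weakly_disc_on (X Y : topologicalType) (A : set X) (f : X -> Y) :
  Prop :=
  forall D : set X, D `<=` A -> D !=set0 ->
  exists x, D x /\ exists2 V, nbhs x V & continuous_on (D `&` V) f.

(** For subsets of metrizable spaces these are the resolvable sets, or H-sets,
relative to A. *)
Definition resolvable_in (X : topologicalType) (A S : set X) : Prop :=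
  forall D : set X, D `<=` A -> D !=set0 ->
  exists x, D x /\
    exists2 V, nbhs x V & D `&` V `<=` S \/ D `&` V `<=` ~` S.

(** Total functions with conditions on subsets take the place of maps between
subspace types. *)
Definition weakly_homeo (X Y : topologicalType) (A : set X) (B : set Y) :
  Prop :=
  exists (f : X -> Y) (g : Y -> X),
    [/\ forall x, A x -> B (f x) /\ g (f x) = x,
        forall y, B y -> A (g y) /\ f (g y) = y,
        weakly_disc_on A f & weakly_disc_on B g].

Section continuity_on.
Context {X Y Z : topologicalType}.
Implicit Types (A : set X) (B : set Y) (f : X -> Y) (g : Y -> Z).

Lemma continuous_onS A A' f :
  A' `<=` A -> continuous_on A f -> continuous_on A' f.
Proof.
move=> AA fc x A'x V /(fc x (AA _ A'x)); apply: filterS => y yV /AA; exact: yV.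
Qed.

Lemma continuous_onE A f f' : (forall x, A x -> f x = f' x) ->
  continuous_on A f -> continuous_on A f'.
Proof.
move=> ff' fc x Ax V; rewrite -ff'// => /(fc x Ax).
by apply: filterS => y yV Ay; rewrite -ff'//; exact: yV.
Qed.

Lemma continuous_on_comp A B f g : (forall x, A x -> B (f x)) ->
  continuous_on A f -> continuous_on B g -> continuous_on A (g \o f).
Proof.
move=> fAB fc gc x Ax V /(gc _ (fAB _ Ax))/(fc _ Ax).
by apply: filterS => y yV Ay; apply: yV => //; exact: fAB.
Qed.

Lemma continuous_on_total A f : continuous f -> continuous_on A f.
Proof.
move=> fc x Ax V Vx; have : nbhs x (f @^-1` V) by exact: fc.
by apply: filterS => y Vy _.
Qed.

Lemma weakly_discS A A' f :
  A' `<=` A -> weakly_disc_on A f -> weakly_disc_on A' f.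
Proof. by move=> AA fw D DA' D0; apply: fw => // x /DA'/AA. Qed.

Lemma continuous_on_weakly_disc A f : continuous_on A f -> weakly_disc_on A f.
Proof.
move=> fc D DA [x Dx]; exists x; split=> //; exists setT; first exact: filterT.
by apply: continuous_onS fc => y [/DA].
Qed.

(** First shrink D to a part where f is continuous, then shrink the image of
that part to a place where g is continuous; the preimage is relatively open. *)
Lemma weakly_disc_comp A B f g : (forall x, A x -> B (f x)) ->
  weakly_disc_on A f -> weakly_disc_on B g -> weakly_disc_on A (g \o f).
Proof.
move=> fAB fw gw D DA D0; have [x [Dx [V Vx fc]]] := fw D DA D0.
have [||_ [[x' [Dx' Vx'] <-] [W Wx' gc]]] := gw (f @` (D `&` V°)).
- by move=> _ [z [Dz _] <-]; exact/fAB/DA.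
- by exists (f x), x => //; split=> //; exact: Vx.
have Vx'' : nbhs x' V by exact: Vx'.
exists x'; split=> //.
pose O := [set y | (D `&` V) y -> W (f y)].
have Ox' : nbhs x' O by apply: fc => //; split => //; exact: nbhs_singleton.
exists (V° `&` O); first by apply: filterI => //; exact: nbhs_interior.
apply: (continuous_on_comp (B := f @` (D `&` V°) `&` W)) => //.
- move=> y [Dy [Vy Oy]]; split; first by exists y.
  by apply: Oy; split=> //; exact: nbhs_singleton.
- apply: continuous_onS fc => y [Dy [Vy _]]; split=> //; exact: nbhs_singleton.
Qed.

(** This is the reason why resolvable sets matter: below any D one can pass to
a relatively open part on which only one of the two maps is used. *)
Lemma weakly_disc_piece A S f f' :
  resolvable_in A S -> weakly_disc_on (A `&` S) f ->
    weakly_disc_on (A `\` S) f' ->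
  weakly_disc_on A (fun x => if `[< S x >] then f x else f' x).
Proof.
move=> hS fw fw' D DA D0; have [x [Dx [V Vx DVS]]] := hS D DA D0.
have Dn : (D `&` V°) !=set0 by exists x; split=> //; exact: Vx.
have VV : V° `<=` V by exact: interior_subset.
case: DVS => DVS.
- have [|y [[Dy Vy] [W Wy fc]]] := fw (D `&` V°) _ Dn.
    by move=> y [Dy /VV Vy]; split; [exact: DA|exact: DVS].
  exists y; split=> //; exists (V° `&` W).
    by apply: filterI => //; exact: nbhs_interior.
  rewrite setIA; apply: continuous_onE fc => z [[Dz /VV Vz] _].
  by case: asboolP => // -[]; exact: DVS.
- have [|y [[Dy Vy] [W Wy fc]]] := fw' (D `&` V°) _ Dn.
    by move=> y [Dy /VV Vy]; split; [exact: DA|exact: DVS].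
  exists y; split=> //; exists (V° `&` W).
    by apply: filterI => //; exact: nbhs_interior.
  rewrite setIA; apply: continuous_onE fc => z [[Dz /VV Vz] _].
  by case: asboolP => // Sz; case: (DVS z).
Qed.

Lemma resolvable_preimage A B S f :
  (forall x, A x -> B (f x)) -> continuous_on A f ->
  resolvable_in B S -> resolvable_in A (f @^-1` S).
Proof.
move=> fAB fc hS D DA [x0 Dx0].
have [||_ [[x Dx <-] [V Vx DVS]]] := hS (f @` D).
- by move=> _ [z Dz <-]; exact/fAB/DA.
- by exists (f x0), x0.
exists x; split=> //; exists [set y | A y -> V (f y)].
  exact: fc (DA _ Dx) _ Vx.
by case: DVS => DVS; [left|right] => y [Dy Vy]; apply: DVS; split;
  [exists y|exact/Vy/DA|exists y|exact/Vy/DA].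
Qed.

Lemma resolvableS A A' S : A' `<=` A -> resolvable_in A S -> resolvable_in A' S.
Proof. by move=> AA hS D DA' D0; apply: hS => // x /DA'/AA. Qed.

Lemma resolvableC A S : resolvable_in A S -> resolvable_in A (~` S).
Proof.
move=> hS D DA D0; have [x [Dx [V Vx DVS]]] := hS D DA D0.
by exists x; split=> //; exists V => //; rewrite setCK or_comm.
Qed.

Lemma resolvableE A S S' :
  A `&` S = A `&` S' -> resolvable_in A S -> resolvable_in A S'.
Proof.
move=> SS' hS D DA D0; have [x [Dx [V Vx DVS]]] := hS D DA D0.
exists x; split=> //; exists V => //.
have SE y : D y -> S y <-> S' y.
  move=> /DA Ay; split=> Sy; first by have : (A `&` S) y by [];
    rewrite SS' => -[].
  by have : (A `&` S') y by []; rewrite -SS' => -[].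
case: DVS => DVS; [left|right] => y [Dy Vy]; have DVy := DVS y (conj Dy Vy).
  exact/(SE y Dy).
by move=> /(SE y Dy).
Qed.

End continuity_on.

(** The union of all open sets on which the restriction to A is continuous is
dense in A: otherwise the part of A away from it would contain another one. *)
Lemma weakly_disc_weakly_discontinuous (X Y : topologicalType) (f : X -> Y) :
  weakly_disc_on setT f -> weakly_discontinuous f.
Proof.
move=> fw A; pose V := \bigcup_(O in [set O | open O /\
  continuous_on (A `&` O) f]) O.
exists V; split.
- by apply: bigcup_open => O [].
- move=> x Ax O /nbhs_interior Ox.
  have [|y [[Ay Oy] [W Wy fc]]] := fw (A `&` O°) (@subsetT _ _).
    by exists x; split=> //; exact: nbhs_singleton.
  exists y; split; last exact: interior_subset.
  split=> //; exists (O° `&` W°).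
    split; first by apply: openI; exact: open_interior.
    rewrite setIA; apply: continuous_onS fc => z [? ?]; split=> //;
      exact: interior_subset.
  by split.
- apply/subspace_continuousP => x [Ax [U [oU fc] Ux]].
  move=> W /(fc x (conj Ax Ux)) => fW.
  have Un : nbhs x U by exact: open_nbhs_nbhs.
  rewrite /nbhs/= /within/=; apply: filterS2 Un fW => y Uy yW [Ay _]; exact: yW.
Qed.

Lemma weakly_homeo_weakly_homeomorphic (X Y : topologicalType) :
  weakly_homeo [set: X] [set: Y] -> weakly_homeomorphic X Y.
Proof.
move=> [f [g [fg gf fw gw]]]; exists f, g; split.
- by move=> x; case: (fg x).
- by move=> x; case: (gf x).
- exact: weakly_disc_weakly_discontinuous.
- exact: weakly_disc_weakly_discontinuous.
Qed.

Lemma weakly_homeo_sym (X Y : topologicalType) (A : set X) (B : set Y) :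
  weakly_homeo A B -> weakly_homeo B A.
Proof. by move=> [f [g [? ? ? ?]]]; exists g, f; split. Qed.

Lemma weakly_homeo_trans (X Y Z : topologicalType) (A : set X) (B : set Y) (C :
  set Z) :
  weakly_homeo A B -> weakly_homeo B C -> weakly_homeo A C.
Proof.
move=> [f [f' [f1 f2 fw fw']]] [g [g' [g1 g2 gw gw']]].
exists (g \o f), (f' \o g'); split=> /=.
- move=> x /f1[Bx fx]; have [Cx gx] := g1 _ Bx; by rewrite gx.
- move=> x /g2[Bx fx]; have [Cx gx] := f2 _ Bx; by rewrite gx.
- by apply: (weakly_disc_comp (B := B)) => // x /f1[].
- by apply: (weakly_disc_comp (B := B)) => // x /g2[].
Qed.

(** The last clause says that f is a closed map onto its image in B, which
makes the inverse continuous without naming it. *)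
Definition closed_embedding (X Y : topologicalType) (A : set X) (B : set Y)
    (f : X -> Y) : Prop :=
  [/\ forall x, A x -> B (f x),
      continuous_on A f,
      forall x y, A x -> A y -> f x = f y -> x = y
    & forall F, closed F -> forall y, B y -> closure (f @` (A `&` F)) y ->
        exists2 x, (A `&` F) x & f x = y].

Section closed_embeddings.
Context {X Y Z : topologicalType}.
Implicit Types (A : set X) (B : set Y) (C : set Z).

Lemma closed_embedding_comp A B C (f : X -> Y) (g : Y -> Z) :
  closed_embedding A B f -> closed_embedding B C g ->
    closed_embedding A C (g \o f).
Proof.
move=> [fAB fc fi fcl] [gBC gc gi gcl]; split=> /=.
- by move=> x /fAB/gBC.
- exact: continuous_on_comp fc gc.
- move=> x y Ax Ay /gi fxy; apply: fi => //; apply: fxy; exact: fAB.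
- move=> F cF z Cz zcl.
  have [||y [By yF] yz] := gcl (closure (f @` (A `&` F))) _ z Cz.
  + exact: closed_closure.
  + apply: closure_subset zcl => _ [x [Ax Fx] <-]; exists (f x) => //.
    by split; [exact: fAB|apply: subset_closure; exists x].
  + by have [x AFx xy] := fcl F cF y By yF; exists x => //; rewrite -yz -xy.
Qed.

Lemma closed_embedding_image_closed A B (f : X -> Y) (y : Y) :
  closed_embedding A B f ->
  B y -> closure (f @` A) y -> (f @` A) y.
Proof.
move=> [_ _ _ fcl] By ycl.
by have [|x [Ax _] <-] := fcl setT closedT y By; [rewrite setIT|exists x].
Qed.

(** The map d only supplies values outside the image of A. *)
Lemma closed_embedding_inv A B (f : X -> Y) (d : Y -> X) :
  closed_embedding A B f ->
  exists2 f' : Y -> X, forall x, A x -> f' (f x) = x & continuous_on (f @` A)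
    f'.
Proof.
move=> [fAB fc fi fcl].
pose f' y := if pselect (exists2 x, A x & f x = y) is left e
             then projT1 (cid2 e) else d y.
have f'K x : A x -> f' (f x) = x.
  move=> Ax; rewrite /f'; case: pselect; last by case; exists x.
  by move=> e; case: cid2 => x' Ax' /= /fi; exact.
exists f' => // _ [x Ax <-] V; rewrite f'K// => Vx.
have : ~ closure (f @` (A `&` ~` V°)) (f x).
  move=> /fcl; case; first by apply: open_closedC; exact: open_interior.
    exact: fAB.
  move=> x' [Ax' Vx'] /fi xx'; apply: Vx'; rewrite xx'//; exact: Vx.
move=> /existsNP[W /not_implyP[Wx WA]].
apply: filterS Wx => y + [x' Ax' fx']; rewrite -{y}fx' f'K// => Wy.
apply: interior_subset; apply: contrapT => nV; apply: WA.
by exists (f x'); split=> //; exists x'.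
Qed.

(** Outside the closed image of A nothing happens, and on the image the
homeomorphism transports relatively open sets. *)
Lemma resolvable_image A B (f : X -> Y) S :
  closed_embedding A B f -> S `<=` A ->
  resolvable_in A S -> resolvable_in B (f @` S).
Proof.
move=> fe SA hS D DB [y0 Dy0].
have [[y Dy /= Ay]|DA] := pselect (exists2 y, D y & ~ (f @` A) y).
  have : ~ closure (f @` A) y.
    by move=> /(closed_embedding_image_closed fe (DB _ Dy)) [x Ax xy];
      apply: Ay; exists x.
  move=> /existsNP[W /not_implyP[Wx WA]].
  exists y; split=> //; exists W => //; right => z [Dz Wz] [x Sx xz].
  by apply: WA; exists z; split => //; exists x => //; exact: SA.
have DfA y : D y -> (f @` A) y.
  by move=> Dy; apply: contrapT => yA; apply: DA; exists y.
have [f' f'K f'c] : exists2 f' : Y -> X, forall x, A x -> f' (f x) = x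
    & continuous_on (f @` A) f'.
  have [x0 Ax0 _] := DfA _ Dy0.
  exact: closed_embedding_inv (fun=> x0) fe.
have [||x [[Ax Dx] [V Vx DVS]]] := hS (A `&` f @^-1` D).
- by move=> x [].
- by have [x Ax xy] := DfA _ Dy0; exists x; split => //=; rewrite xy.
exists (f x); split=> //; exists [set y | (f @` A) y -> V (f' y)].
  by apply: f'c; [exists x|rewrite f'K].
case: DVS => DVS; [left|right] => y [Dy Vy]; have [z Az zy] := DfA y Dy;
  have := Vy (DfA y Dy); rewrite -zy f'K// => Vz.
- by exists z => //; apply: DVS; split=> //; split=> //=; rewrite zy.
- have nSz : ~ S z by apply: DVS; split=> //; split=> //=; rewrite zy.
  move=> [z' Sz'] fz; apply: nSz.
  by have [_ _ fi _] := fe; rewrite -(fi z' z)//; exact: SA.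
Qed.

Lemma resolvable_relclosed A S :
  (forall x, A x -> closure S x -> S x) -> resolvable_in A S.
Proof.
move=> cS D DA [x0 Dx0].
have [[x Dx /= Sx]|DS] := pselect (exists2 x, D x & ~ S x).
  have : ~ closure S x by move=> /(cS _ (DA _ Dx)).
  move=> /existsNP[W /not_implyP[Wx WA]].
  exists x; split=> //; exists W => //; right => z [Dz Wz] Sz.
  by apply: WA; exists z.
exists x0; split=> //; exists setT; first exact: filterT.
by left => x [Dx _]; apply: contrapT => nS; apply: DS; exists x.
Qed.

End closed_embeddings.

(** * The Cantor-Bernstein bijection *)

Section Cantor_Bernstein.
Context {X Y : topologicalType} (A : set X) (B : set Y).
Variables (f : X -> Y) (g : Y -> X) (f' : Y -> X) (g' : X -> Y).
Hypotheses (fAB : forall x, A x -> B (f x)) (gBA : forall y, B y -> A (g y)).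
Hypotheses (f'K : forall x, A x -> f' (f x) = x).
Hypotheses (g'K : forall y, B y -> g' (g y) = y).
Hypotheses (fc : continuous_on A f) (gc : continuous_on B g).
Hypotheses (f'c : continuous_on (f @` A) f') (g'c : continuous_on (g @` B) g').

(** The decreasing chain A, g(B), g(f(A)), g(f(g(B))), ... *)
Fixpoint cb_chain (k : nat) : set X :=
  match k with
  | 0 => A
  | 1 => g @` B
  | k.+2 => (g \o f) @` cb_chain k
  end.

(** When f is a closed embedding all members of the chain are closed. The
weaker demand on the even ones covers the inclusion of a non-closed set in a
compact space. *)
Hypothesis chain_even : forall m, resolvable_in A (cb_chain m.*2).
Hypothesis chain_odd : forall m x, A x ->
  closure (cb_chain m.*2.+1) x -> cb_chain m.*2.+1 x.

Let chainS k : cb_chain k.+1 `<=` cb_chain k.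
Proof.
suff : cb_chain k.+1 `<=` cb_chain k /\ cb_chain k.+2 `<=` cb_chain k.+1.
  by case.
elim: k => [|k [IH1 IH2]]; split=> //=.
- by move=> _ [y By <-]; exact: gBA.
- by move=> _ [x Ax <-]; exists (f x) => //; exact: fAB.
- by move=> _ [x /IH1 Ax <-]; exists x.
Qed.

Let chain_le k l : (k <= l)%N -> cb_chain l `<=` cb_chain k.
Proof.
by move=> /subnK <-; elim: (l - k)%N => // n IH; rewrite addSn => x /chainS/IH.
Qed.

(** On P the bijection follows f; elsewhere it follows the inverse of g. *)
Let P : set X := [set x | exists2 n, cb_chain n.*2 x & ~ cb_chain n.*2.+1 x].

(** The first odd member of the chain that does not contain D cuts off a
relatively open part of D; this part lies in the previous odd member, so that
only the even member in between decides about membership in P. *)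
Let P_resolvable : resolvable_in A P.
Proof.
move=> D DA [x0 Dx0].
pose Q m := `[< exists2 x, D x & ~ cb_chain m.*2.+1 x >].
have [exQ|nQ] := pselect (exists m, Q m); last first.
  exists x0; split=> //; exists setT; first exact: filterT.
  right => x [Dx _] [n _ nx]; apply: nQ; exists n; apply/asboolP; by exists x.
have := find_ex_minn exQ => -[m /asboolP [x Dx nx] minm].
have : ~ closure (cb_chain m.*2.+1) x by move=> /(chain_odd (DA _ Dx)).
move=> /existsNP[W /not_implyP[Wx WA]].
have [||y [[Dy Wy] [V Vy DVS]]] := @chain_even m (D `&` W°).
- by move=> y [/DA].
- by exists x; split=> //; exact: Wx.
exists y; split=> //; exists (V `&` W°).
  by apply: filterI => //; exact: nbhs_interior.
have out z : D z -> W° z -> ~ cb_chain m.*2.+1 z.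
  by move=> Dz /nbhs_singleton Wz mz; apply: WA; exists z.
case: DVS => DVS; [left|right] => z [Dz [Vz Wz]].
  by exists m; [apply: DVS|exact: out].
have nz : ~ cb_chain m.*2 z by exact: DVS.
move=> [n nz1 nz2]; have [mn|nm] := leqP m n.
  by apply: nz; apply: chain_le nz1; rewrite leq_double.
apply: nz2; apply: contrapT => nz2.
have : Q n by apply/asboolP; exists z.
by move=> /minm; rewrite leqNgt nm.
Qed.

Let finj x y : A x -> A y -> f x = f y -> x = y.
Proof. by move=> Ax Ay fxy; rewrite -(f'K Ax) fxy f'K. Qed.

Let ginj x y : B x -> B y -> g x = g y -> x = y.
Proof. by move=> Ax Ay fxy; rewrite -(g'K Ax) fxy g'K. Qed.

Let chainA k : cb_chain k `<=` A.
Proof. exact: chain_le (leq0n k). Qed.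

Lemma Cantor_Bernstein : weakly_homeo A B.
Proof.
have PA : P `<=` A by move=> x [n /chainA].
have chSS k : cb_chain k.+2 = (g \o f) @` cb_chain k by [].
have Ph x : P x -> P (g (f x)).
  move=> [n nx nx1]; exists n.+1; first by rewrite doubleS chSS; exists x.
  rewrite doubleS chSS => -[z zn zx]; apply: nx1.
  have Az := chainA zn; have Ax := chainA nx.
  by rewrite -(@finj z x) //; apply: ginj zx; exact: fAB.
have Pg y : B y -> P (g y) -> exists2 x, P x & f x = y.
  move=> By [[|n] ny ny1]; first by exfalso; apply: ny1 => /=; exists y.
  move: ny; rewrite doubleS chSS => -[z zn zy].
  have Az := chainA zn; have fz : f z = y by apply: ginj zy => //; exact: fAB.
  exists z => //; exists n => // zn1; apply: ny1; rewrite doubleS chSS.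
  by exists z.
have nP x : A x -> ~ P x -> (g @` B) x.
  by move=> Ax nPx; apply: contrapT => gx; apply: nPx; exists 0.
exists (fun x => if `[< P x >] then f x else g' x).
exists (fun y => if `[< P (g y) >] then f' y else g y); split.
- move=> x Ax; case: asboolP => Px.
    split; first exact: fAB.
    by case: asboolP => [?|[]]; [exact: f'K|exact: Ph].
  have [y By gy] := nP _ Ax Px; have -> : g' x = y by rewrite -gy g'K.
  by split=> //; case: asboolP => //; rewrite gy.
- move=> y By; case: asboolP => Py.
    have [x Px xy] := Pg _ By Py; rewrite -xy f'K; last exact: PA.
    by split; [exact: PA|rewrite asboolT].
  by split; [exact: gBA|case: asboolP => //; rewrite g'K].
- apply: weakly_disc_piece => //.
    by apply: continuous_on_weakly_disc; apply: continuous_onS fc => x [].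
  by apply: continuous_on_weakly_disc; apply: continuous_onS g'c => x [Ax Px];
    exact: nP.
- apply: (@weakly_disc_piece _ _ B (g @^-1` P) f' g).
  + exact: resolvable_preimage gc P_resolvable.
  + apply: continuous_on_weakly_disc; apply: continuous_onS f'c => y [By /(Pg _
      By)[x Px <-]].
    by exists x => //; exact: PA.
  + by apply: continuous_on_weakly_disc; apply: continuous_onS gc => y [].
Qed.

End Cantor_Bernstein.

Lemma weakly_homeo_closed_embedding (X Y : topologicalType) (A : set X) (B :
  set Y) f g :
  closed_embedding A B f -> closed_embedding B A g -> weakly_homeo A B.
Proof.
move=> fe ge; have [f' f'K f'c] := closed_embedding_inv g fe.
have [g' g'K g'c] := closed_embedding_inv f ge.
have [fAB fc fi fcl] := fe; have [gBA gc gi gcl] := ge.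
have hcl := closed_embedding_comp fe ge.
have ch k x : A x -> closure (cb_chain A B f g k) x -> cb_chain A B f g k x.
  suff : cb_chain A B f g k `<=` A /\ (forall x, A x ->
      closure (cb_chain A B f g k) x -> cb_chain A B f g k x) by case=> _;
        apply.
  move: x => _.
  have [n] := ubnP k; elim: n k => // n IH [|[|k]] /= kn.
  - by split.
  - split; first by move=> _ [y By <-]; exact: gBA.
    move=> x Ax; exact: closed_embedding_image_closed ge Ax.
  - have [kA kcl] := IH k (ltnW kn); split.
      by move=> _ [x /kA Ax <-]; exact/gBA/fAB.
    move=> x Ax xcl; have [_ _ _ hc] := hcl.
    have AZ : A `&` closure (cb_chain A B f g k) = cb_chain A B f g k.
      rewrite eqEsubset; split => [y [Ay]|y ky]; first exact: kcl.
      by split; [exact: kA|exact: subset_closure].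
    have := hc _ (@closed_closure _ (cb_chain A B f g k)) x Ax.
    by rewrite AZ => /(_ xcl) [z zk zx]; exists z.
apply: (Cantor_Bernstein fAB gBA f'K g'K) => //.
- by move=> m; apply: resolvable_relclosed => x Ax /ch; exact.
- by move=> m x Ax /ch; exact.
Qed.

(** * Cylinders, Borel classes and Baire category in the Cantor space *)

Lemma exists_choice (T U : Type) (P : T -> U -> Prop) :
  (forall x, exists y, P x y) -> exists f, forall x, P x (f x).
Proof. by move=> /choice[f fP]; exists f. Qed.

Definition cyl (T : Type) (x : nat -> T) (N : nat) : set (nat -> T) :=
  [set y | forall i, (i < N)%N -> y i = x i].

Section cylinders.
Context {T : Type}.
Implicit Types x y z : nat -> T.

Lemma cyl_refl x N : cyl x N x. Proof. by []. Qed.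

Lemma cyl_sym x y N : cyl x N y -> cyl y N x.
Proof. by move=> xy i iN; rewrite xy. Qed.

Lemma cyl_trans x y z N : cyl x N y -> cyl y N z -> cyl x N z.
Proof. by move=> xy yz i iN; rewrite yz// xy. Qed.

Lemma cyl_le x M N : (M <= N)%N -> cyl x N `<=` cyl x M.
Proof. by move=> MN y xy i iM; apply: xy; exact: leq_trans MN. Qed.

Lemma cyl_sub x y M N : (M <= N)%N -> cyl x M y -> cyl y N `<=` cyl x M.
Proof. by move=> MN xy z /(cyl_le MN); exact: cyl_trans. Qed.

Lemma cylS x y N : cyl x N y -> y N = x N -> cyl x N.+1 y.
Proof. by move=> xy e i; rewrite ltnS leq_eqVlt => /predU1P[->//|/xy]. Qed.

Lemma cyl_nested (s : nat -> (nat -> T) * nat) :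
  (forall n, cyl (s n).1 (s n).2 (s n.+1).1) ->
  (forall n, ((s n).2 < (s n.+1).2)%N) ->
  forall n, cyl (s n).1 (s n).2 (fun i => (s i.+1).1 i).
Proof.
move=> s1 s2.
have sle n : (n <= (s n).2)%N.
  by elim: n => // n IH; exact: leq_ltn_trans IH (s2 n).
have sub n m : (n <= m)%N ->
    cyl (s n).1 (s n).2 (s m).1 /\ ((s n).2 <= (s m).2)%N.
  move=> /subnK <-; elim: (m - n)%N => // k [IH1 IH2]; rewrite addSn; split.
    by apply: cyl_sub (s1 _) => //; exact: cyl_refl.
  exact: leq_trans IH2 (ltnW (s2 _)).
move=> n i iN /=; have [ni|ni] := leqP n i.+1.
  by have [h _] := sub _ _ ni; rewrite h.
by have [h _] := sub _ _ (ltnW ni); rewrite h.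
Qed.

End cylinders.

Lemma nbhs_cylP (T : discreteTopologicalType)
    (x : prod_topology (fun _ : nat => T)) (V : set (nat -> T)) :
  nbhs x V <-> exists N, cyl x N `<=` V.
Proof.
split=> [|[N NV]].
  pose F : set_system (nat -> T) := [set W | exists N, cyl x N `<=` W].
  have FF : Filter F.
    split.
    - by exists 0.
    - move=> P Q [N NP] [M MQ]; exists (maxn N M) => y xy; split.
        by apply: NP; apply: cyl_le xy; exact: leq_maxl.
      by apply: MQ; apply: cyl_le xy; exact: leq_maxr.
    - by move=> P Q PQ [N NP]; exists N => y /NP/PQ.
  suff Fx : F --> x by move=> /Fx.
  apply/cvg_sup => n U [V' [[W oW <-] WfN WU]].
  exists n.+1 => y xy; apply: WU => /=; rewrite /= in WfN.
  by rewrite xy.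
have FF : Filter (nbhs x) := nbhs_filter x.
apply: filterS NV _; elim: N => [|N IH].
  by apply: filterS filterT => y _ i.
have : nbhs x (@proj _ (fun _ : nat => T) N @^-1` [set x N]).
  by apply: proj_continuous; exact: discrete_set1.
by apply: filterS2 IH => y xy yN; exact: cylS.
Qed.

Lemma countable_range (T : Type) (A : set T) : countable A -> A !=set0 ->
  exists f : nat -> T, A = range f.
Proof.
move=> /pfcard_geP[->[x []]|[f] _]; exists f; rewrite eqEsubset; split=> x.
  by move=> /(@surj _ _ _ _ f)[n _ <-]; exists n.
by move=> [n _ <-]; exact: funS.
Qed.

Notation Om := cantor_space.

Lemma nbhs_cantorP (x : Om) (V : set Om) :
  nbhs x V <-> exists N, cyl x N `<=` V.
Proof. exact: (@nbhs_cylP bool). Qed.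

Lemma nbhs_baireP (x : baire_space) (V : set baire_space) :
  nbhs x V <-> exists N, cyl x N `<=` V.
Proof. exact: (@nbhs_cylP nat). Qed.

Section cantor_sets.
Implicit Types (x y : Om) (A X K : set Om).

Lemma nbhs_cyl x N : nbhs x (cyl x N : set Om).
Proof. by apply/nbhs_cantorP; exists N. Qed.

Lemma cyl_open x N : open (cyl x N : set Om).
Proof.
rewrite openE => y xy; apply/nbhs_cantorP; exists N => z; exact: cyl_trans.
Qed.

Lemma cyl_closed x N : closed (cyl x N : set Om).
Proof.
move=> y /(_ _ (nbhs_cyl y N)) [z [xz yz]]; apply: cyl_trans xz _.
exact: cyl_sym.
Qed.

Lemma closure_cylP A x : closure A x <-> forall N, exists2 y, A y & cyl x N y.
Proof.
split=> [cA N|cA V /nbhs_cantorP[N NV]].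
  by have [y [Ay xy]] := cA _ (nbhs_cyl x N); exists y.
by have [y Ay /NV Vy] := cA N; exists y.
Qed.

Lemma closed_cyl K x : closed K -> ~ K x ->
  exists N, forall y, cyl x N y -> ~ K y.
Proof.
move=> cK nK; apply: contrapT => /forallNP nN; apply/nK/cK/closure_cylP => N.
have /existsNP[y /not_implyP[xy /contrapT Ky]] := nN N; by exists y.
Qed.

(** Words give a countable index set for all cylinders. *)
Definition wcyl (u : seq bool) : set Om := cyl (nth false u) (size u).

Lemma cyl_word x N : exists u, cyl x N = wcyl u.
Proof.
exists (mkseq x N); rewrite /wcyl size_mkseq eqEsubset.
by split=> y xy i iN; rewrite xy// nth_mkseq.
Qed.

Lemma wcyl_open u : open (wcyl u). Proof. exact: cyl_open. Qed.

Lemma wcyl_closed u : closed (wcyl u). Proof. exact: cyl_closed. Qed.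

Definition fsigma A := exists K : nat -> set Om,
  (forall n, closed (K n)) /\ A = \bigcup_n K n.

Definition gdelta A := fsigma (~` A).

Lemma fsigma_closed A : closed A -> fsigma A.
Proof.
move=> cA; exists (fun=> A); split=> //; rewrite eqEsubset;
  split=> [x Ax|x []//].
by exists 0.
Qed.

Lemma fsigma_countbigcup (I : countType) (F : I -> set Om) :
  (forall i, fsigma (F i)) -> fsigma (\bigcup_i F i).
Proof.
move=> /choice[K KP].
exists (fun n => if unpickle n is Some p then K p.1 p.2 else set0); split.
  by move=> n; case: unpickle => [p|]; [case: (KP p.1)|exact: closed0].
rewrite eqEsubset; split=> [x [i _]|x [n _]].
  have [_ ->] := KP i => -[n _ Kx]; exists (pickle (i, n)) => //.
  by rewrite pickleK.
case: unpickle => // -[i m] Kx; exists i => //.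
by have [_ ->] := KP i; exists m.
Qed.

Lemma fsigmaI A A' : fsigma A -> fsigma A' -> fsigma (A `&` A').
Proof.
move=> [K [Kc ->]] [L [Lc ->]].
have -> : \bigcup_n K n `&` \bigcup_n L n =
    \bigcup_(p : nat * nat) (K p.1 `&` L p.2).
  rewrite eqEsubset; split=> [x [[n _ Kx] [m _ Lx]]|x [[n m] _ [Kx Lx]]].
    by exists (n, m).
  by split; [exists n|exists m].
by apply: fsigma_countbigcup => p; apply: fsigma_closed; exact: closedI.
Qed.

Lemma fsigmaU A A' : fsigma A -> fsigma A' -> fsigma (A `|` A').
Proof.
move=> fA fA'; have -> : A `|` A' = \bigcup_(b : bool) (if b then A else A').
  rewrite eqEsubset; split=> [x [Ax|Ax]|x [[] _ Ax]].
  by exists true. by exists false. by left. by right.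
by apply: fsigma_countbigcup => -[].
Qed.

Lemma fsigma_open A : open A -> fsigma A.
Proof.
move=> oA.
have -> : A = \bigcup_u (if `[< wcyl u `<=` A >] then wcyl u else set0).
  rewrite eqEsubset; split=> [x Ax|x [u _]]; last by case: asboolP => // uA /uA.
  have /nbhs_cantorP[N NA] : nbhs x A by exact: open_nbhs_nbhs.
  have [u uE] := cyl_word x N; exists u => //.
  by rewrite asboolT -uE.
apply: fsigma_countbigcup => u; apply: fsigma_closed; case: asboolP => _.
  exact: wcyl_closed.
exact: closed0.
Qed.

Lemma cantor_closed1 x : closed ([set x] : set Om).
Proof.
move=> y /closure_cylP xy; apply: funext => i.
by have [z -> /(_ i (ltnSn i))] := xy i.+1.
Qed.

Lemma fsigma_countable A : countable A -> fsigma A.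
Proof.
move=> Ac; have [->|/set0P/(countable_range Ac)[f ->]] := eqVneq A set0.
  exact/fsigma_closed/closed0.
rewrite (_ : range f = \bigcup_n [set f n]).
  by apply: fsigma_countbigcup => n; exact/fsigma_closed/cantor_closed1.
by rewrite eqEsubset; split=> [x [n _ <-]|x [n _ ->]]; exists n.
Qed.

Lemma gdelta_closed A : closed A -> gdelta A.
Proof. by move=> cA; apply: fsigma_open; exact: closed_openC. Qed.

Lemma gdelta_open A : open A -> gdelta A.
Proof. by move=> cA; apply: fsigma_closed; exact: open_closedC. Qed.

Lemma gdeltaU A A' : gdelta A -> gdelta A' -> gdelta (A `|` A').
Proof. by rewrite /gdelta setCU; exact: fsigmaI. Qed.

Lemma gdeltaI A A' : gdelta A -> gdelta A' -> gdelta (A `&` A').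
Proof. by rewrite /gdelta setCI; exact: fsigmaU. Qed.

Lemma fsigma_incr A : fsigma A -> exists K : nat -> set Om,
  [/\ forall n, closed (K n), {homo K : m n / (m <= n)%N >-> m `<=` n}
    & A = \bigcup_n K n].
Proof.
move=> [K [Kc ->]]; exists (fun n => \bigcup_(i < n.+1) K i); split.
- by move=> n; apply: closed_bigcup => //; exact: finite_II.
- by move=> m n mn x [i /= im Kx]; exists i => //=; exact: leq_trans mn.
- rewrite eqEsubset; split=> [x [n _ Kx]|x [n _ [i _ Kx]]]; last by exists i.
  by exists n => //; exists n => /=.
Qed.

(** If no L n had interior in K, one could choose shrinking cylinders with
centre in K, the n-th of which avoids L n; their common point would be in K but
in no L n. *)
Lemma cantor_Baire K (L : nat -> set Om) :
  closed K -> K !=set0 -> K `<=` \bigcup_n L n -> (forall n, closed (L n)) ->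
  exists n x N, K x /\ K `&` cyl x N `<=` L n.
Proof.
move=> cK [x0 Kx0] KL cL; apply: contrapT => nK.
have step : forall p : nat * (Om * nat), exists q : Om * nat,
    K p.2.1 -> [/\ K q.1, cyl p.2.1 p.2.2 q.1, (p.2.2 < q.2)%N
      & forall z, cyl q.1 q.2 z -> ~ L p.1 z].
  move=> [n [x N]] /=; have [Kx|] := pselect (K x); last by exists (x, 0).
  have [y [[Ky xy] Ly]] : exists y, (K `&` cyl x N) y /\ ~ L n y.
    apply: contrapT => /forallNP h; apply: nK; exists n, x, N; split=> // y Ky.
    by apply: contrapT => Ly; apply: (h y).
  have [M yM] := closed_cyl (cL n) Ly.
  exists (y, maxn N.+1 M) => _ /=; split=> //; first exact: leq_maxl.
  by move=> z yz; apply: yM; apply: cyl_le yz; exact: leq_maxr.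
have [c cP] := choice step.
pose s := fix s n := if n is m.+1 then c (m, s m) else (x0, 0).
have sK n : K (s n).1 by elim: n => //= n IH; case: (cP (n, s n)).
pose z : Om := fun i => (s i.+1).1 i.
have {}zs n : cyl (s n).1 (s n).2 z.
  by apply: cyl_nested => m; case: (cP (m, s m) (sK m)).
have Kz : K z.
  apply/cK/closure_cylP => N; exists (s N).1 => //; apply: cyl_sym.
  apply: cyl_le (zs N); elim: (N) => // m /leq_ltn_trans; apply.
  by case: (cP (m, s m) (sK m)).
have [n _ Lz] := KL _ Kz.
by have [_ _ _ /(_ z (zs n.+1))] := cP (n, s n) (sK n); apply.
Qed.

(** On the closure of a nonempty set D, the closed pieces of X and of its
complement form a countable closed cover, so that one of them has interior
there. *)
Lemma fsigma_gdelta_resolvable X : fsigma X -> gdelta X -> resolvable_in setT X.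
Proof.
move=> [K [cK XK]] [L [cL XL]] D _ [x0 Dx0].
have [||||n [x [N [Dx DN]]]] := @cantor_Baire (closure D)
    (fun n => if odd n then K n./2 else L n./2).
- exact: closed_closure.
- by exists x0; exact: subset_closure.
- move=> x _; have [Xx|Xx] := pselect (X x).
    move: (Xx); rewrite XK => -[n _ Kx]; exists n.*2.+1 => //=.
    by rewrite odd_double /= uphalf_double.
  have : (~` X) x by []; rewrite XL => -[n _ Lx]; exists n.*2 => //=.
  by rewrite odd_double /= doubleK.
- by move=> n; case: odd.
have /closure_cylP/(_ N) [y Dy xy] := Dx.
exists y; split=> //; exists (cyl y N); first exact: nbhs_cyl.
have sub : D `&` cyl y N `<=` closure D `&` cyl x N.
  move=> z [Dz yz]; split; [exact: subset_closure|exact: cyl_trans yz].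
case: ifPn DN => _ DN; [left|right] => z /sub/DN h.
  by rewrite XK; exists n./2.
by rewrite XL; exists n./2.
Qed.

(** Same Baire argument with the points of X as closed pieces: a countable
G_delta set is scattered. *)
Lemma countable_gdelta_isolated X D : countable X -> gdelta X -> D `<=` X ->
  D !=set0 -> exists x N, D x /\ D `&` cyl x N `<=` [set x].
Proof.
move=> Xc [L [cL XL]] DX [x0 Dx0].
have [|f Xf] := countable_range Xc; first by exists x0; exact: DX.
have [||||n [x [N [Dx DN]]]] := @cantor_Baire (closure D)
    (fun n => if odd n then [set f n./2] else L n./2).
- exact: closed_closure.
- by exists x0; exact: subset_closure.
- move=> x _; have [Xx|Xx] := pselect (X x).
    move: (Xx); rewrite Xf => -[n _ <-]; exists n.*2.+1 => //=.
    by rewrite odd_double /= uphalf_double.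
  have : (~` X) x by []; rewrite XL => -[n _ Lx]; exists n.*2 => //=.
  by rewrite odd_double /= doubleK.
- by move=> n; case: odd => //; exact: cantor_closed1.
have /closure_cylP/(_ N) [y Dy xy] := Dx.
have sub : D `&` cyl y N `<=` closure D `&` cyl x N.
  move=> z [Dz yz]; split; [exact: subset_closure|exact: cyl_trans yz].
exists y, N; split=> // z zD; move: DN (sub _ zD) (sub y (conj Dy (@cyl_refl _
  y N))).
case: ifPn => _ DN zD' yD'; first by rewrite (DN _ zD') (DN _ yD').
have : (~` X) y by rewrite XL; exists n./2 => //; exact: DN.
by case; exact: DX.
Qed.

End cantor_sets.

(** * Splitting off a Polish part *)

Lemma resolvable_open (T : topologicalType) (A V : set T) :
  open V -> resolvable_in A V.
Proof.
move=> oV D DA [x0 Dx0].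
have [[x Dx Vx]|DV] := pselect (exists2 x, D x & V x).
  exists x; split=> //; exists V; first exact: open_nbhs_nbhs.
  by left=> y [].
exists x0; split=> //; exists setT; first exact: filterT.
by right=> y [Dy _] Vy; apply: DV; exists y.
Qed.

Lemma resolvableU (T : topologicalType) (A S S' : set T) :
  resolvable_in A S -> resolvable_in A S' -> resolvable_in A (S `|` S').
Proof.
move=> hS hS' D DA D0; have [x [Dx [V Vx [DVS|DVS]]]] := hS D DA D0.
  by exists x; split=> //; exists V => //; left => y /DVS; left.
have [||y [[Dy Vy] [W Wy DWS]]] := hS' (D `&` V°).
- by move=> y [/DA].
- by exists x; split=> //; exact: Vx.
exists y; split=> //; exists (V° `&` W).
  by apply: filterI => //; exact: nbhs_interior.
case: DWS => DWS; [left|right] => z [Dz [Vz Wz]]; first by right; exact: DWS.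
have Vz' : V z by exact: interior_subset.
by case; [exact: DVS|exact: DWS].
Qed.

Lemma resolvableI (T : topologicalType) (A S S' : set T) :
  resolvable_in A S -> resolvable_in A S' -> resolvable_in A (S `&` S').
Proof.
by move=> /resolvableC hS /resolvableC hS'; rewrite -[S `&` S']setCK setCI;
  exact/resolvableC/resolvableU.
Qed.

Lemma resolvable_closed (T : topologicalType) (A V : set T) :
  closed V -> resolvable_in A V.
Proof. by move=> cV; rewrite -[V]setCK; apply/resolvableC/resolvable_open/closed_openC. Qed.

(** Some nonempty relatively closed part of X has no nonempty clopen piece
which is in C or is Polish. *)
Definition thick (C : set Om -> Prop) (X : set Om) : Prop :=
  exists K : set Om, [/\ closed K, X `&` K !=set0
    & forall x N, X `&` K `&` cyl x N !=set0 ->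
        ~ C (X `&` K `&` cyl x N) /\ ~ gdelta (X `&` K `&` cyl x N)].

Section decomposition.
Variables (C : set Om -> Prop) (X : set Om).
Hypothesis C_bigcup : forall F : nat -> set Om,
  (forall n, C (F n)) -> C (\bigcup_n F n).
Hypothesis C_closed : forall A V, C A -> closed V -> C (A `&` V).
Hypothesis C0 : C set0.

(** The last clause keeps track of the F_sigma class for the sake of the
sigma-compact case. *)
Definition split_on (O P : set Om) : Prop :=
  [/\ P `<=` X `&` O, C ((X `&` O) `\` P), gdelta P,
    resolvable_in X P & fsigma X -> fsigma P].

Let C_setU A A' : C A -> C A' -> C (A `|` A').
Proof.
move=> CA CA'; have -> : A `|` A' = \bigcup_n (if n is 0 then A else A').
  rewrite eqEsubset; split=> [x [Ax|Ax]|x [[|n] _ Ax]]; by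
    [exists 0|exists 1|left|right].
by apply: C_bigcup => -[|n].
Qed.

(** Disjointify the clopen sets and glue the splittings. Being G_delta survives
this infinite union because the pieces are separated by disjoint clopen sets,
and so does resolvability. *)
Lemma split_on_bigcup (W : nat -> set Om) :
  (forall n, open (W n)) -> (forall n, closed (W n)) ->
  (forall n, exists P, split_on (W n) P) ->
  exists P, split_on (\bigcup_n W n) P.
Proof.
move=> oW cW /choice[P PP].
pose D n : set Om := seqDU W n.
have UW n : open (\big[setU/set0]_(k < n) W k) by rewrite -bigcup_mkord;
  apply: bigcup_open.
have CW n : closed (\big[setU/set0]_(k < n) W k) by apply: closed_bigsetU.
have oD n : open (D n) by rewrite /D/seqDU setDE; apply: openI => //;
  exact: closed_openC.
have cD n : closed (D n) by rewrite /D/seqDU setDE; apply: closedI => //;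
  exact: open_closedC.
have DW n : D n `<=` W n by exact: subset_seqDU.
have DE x : (\bigcup_n W n) x -> exists n, D n x.
  by rewrite seqDU_bigcup_eq => -[n _ Dx]; exists n.
have Dinj m n x : D m x -> D n x -> m = n.
  move=> Dm Dn; have /trivIsetP := @trivIset_seqDU _ W.
  move=> /(_ m n Logic.I Logic.I) h; apply/eqP; apply: contrapT => /negP mn.
  by have := h mn; rewrite -subset0 => /(_ x); apply.
exists (\bigcup_n (P n `&` D n)); split.
- move=> x [n _ [Px _]]; have [/(_ x Px)[Xx Wx] _ _ _ _] := PP n.
  by split=> //; exists n.
- have -> : (X `&` \bigcup_n W n) `\` \bigcup_n (P n `&` D n) =
      \bigcup_n (((X `&` W n) `\` P n) `&` D n).
    rewrite eqEsubset; split=> [x [[Xx /DE[n Dx]] nP]|x [n _ [[[Xx Wx] nP]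
      Dx]]].
      exists n => //; split=> //; split; first by split=> //; exact: DW.
      by move=> Px; apply: nP; exists n.
    split; first by split=> //; exists n.
    by move=> [m _ [Px Dm]]; apply: nP; rewrite (Dinj n m x).
  by apply: C_bigcup => n; apply: C_closed => //; case: (PP n).
- rewrite /gdelta.
  have -> : ~` (\bigcup_n (P n `&` D n)) =
      ~` (\bigcup_n W n) `|` \bigcup_n (D n `&` ~` P n).
    rewrite eqEsubset; split=> [x nP|x [nW [n _ [Px Dx]]|[n _ [Dx nP]] [m _ [Px
      Dm]]]].
    + have [/DE[n Dx]|] := pselect ((\bigcup_n W n) x); last by left.
      by right; exists n => //; split=> // Px; apply: nP; exists n.
    + by apply: nW; exists n => //; exact: DW.
    + by apply: nP; rewrite (Dinj n m x).
  apply: fsigmaU.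
    by apply/fsigma_closed/open_closedC/bigcup_open => n _.
  apply: fsigma_countbigcup => n; apply: fsigmaI; first exact: fsigma_closed.
  by case: (PP n).
- move=> A AX [x0 Ax0].
  have [[x Ax /DE[n Dx]]|nW] := pselect (exists2 x, A x & (\bigcup_n W n) x);
      last first.
    exists x0; split=> //; exists setT; first exact: filterT.
    right=> x [Ax _] [n _ [_ Dx]]; apply: nW; exists x => //; exists n => //.
    exact: DW.
  have [_ _ _ hP _] := PP n.
  have [||y [[Ay Dy] [V Vy AV]]] := hP (A `&` D n).
  + by move=> y [/AX].
  + by exists x.
  exists y; split=> //; exists (D n `&` V).
    by apply: filterI => //; exact: open_nbhs_nbhs.
  case: AV => AV; [left|right] => z [Az [Dz Vz]].
    by exists n => //; split=> //; exact: AV.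
  by move=> [m _ [Pz Dm]]; apply: (AV z) => //; rewrite (Dinj n m z).
- move=> fX; apply: fsigma_countbigcup => n; apply: fsigmaI;
    last exact: fsigma_closed.
  by case: (PP n) => _ _ _ _; exact.
Qed.

Let split_on0 : split_on set0 set0.
Proof.
split.
- exact: sub0set.
- by rewrite setI0 setD0.
- exact/gdelta_closed/closed0.
- exact/resolvable_closed/closed0.
- by move=> _; exact/fsigma_closed/closed0.
Qed.

(** Let O be the union of the cylinders that can be split; it can be split
itself. If O missed a point of X, then X minus O would be relatively closed
and, X not being thick, would meet some cylinder in a set that is in C or
G_delta. Adding this set to the corresponding part of the splitting of O would
split that cylinder, although the cylinder is not contained in O. *)
Lemma decomposition : ~ thick C X -> exists P, split_on setT P.
Proof.
move=> nX; pose good u := exists P, split_on (wcyl u) P.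
pose W n := if unpickle n is Some u then
  (if `[< good u >] then wcyl u else set0) else set0.
have [||| P0 P0P] := @split_on_bigcup W.
- by move=> n; rewrite /W; case: unpickle => [u|]; [case: asboolP => _|];
    [exact: wcyl_open|exact: open0|exact: open0].
- by move=> n; rewrite /W; case: unpickle => [u|]; [case: asboolP => _|];
    [exact: wcyl_closed|exact: closed0|exact: closed0].
- move=> n; rewrite /W; case: unpickle => [u|]; last by exists set0.
  by case: asboolP => // _; exists set0.
pose O := \bigcup_n W n.
have goodO u : good u -> wcyl u `<=` O.
  by move=> gu x ux; exists (pickle u) => //; rewrite /W pickleK asboolT.
have XO : X `<=` O.
  apply: contrapT => /existsNP[x /not_implyP[Xx Ox]]; apply: nX.
  have cO : closed (~` O).
    apply/open_closedC/bigcup_open => n _; rewrite /W.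
    by case: unpickle => [u|]; [case: asboolP => _|];
      [exact: wcyl_open|exact: open0|exact: open0].
  exists (~` O); split=> //; first by exists x.
  move=> y N [z [[Xz Oz] yz]]; have [u uE] := cyl_word y N.
  have [P0X CP0 gP0 hP0 fP0] := P0P.
  rewrite uE; split=> h; apply: (Oz); apply: (goodO u); rewrite -?uE//.
  + exists (P0 `&` wcyl u); split.
    * by move=> w [/P0X[Xw _] uw].
    * have -> : (X `&` wcyl u) `\` (P0 `&` wcyl u) =
          (X `&` ~` O `&` wcyl u) `|` (((X `&` O) `\` P0) `&` wcyl u).
        rewrite eqEsubset; split=> [w [[Xw uw] nP]|w].
          have [Ow|Ow] := pselect (O w); last by left.
          by right; split=> //; split=> // Pw; apply: nP.
        move=> [[[Xw nO] uw]|[[[Xw Ow] nP] uw]]; split=> // -[Pw _] //.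
        by apply: nO; have [] := P0X _ Pw.
      by apply: C_setU => //; apply: C_closed => //; exact: wcyl_closed.
    * by apply: gdeltaI => //; exact/gdelta_open/wcyl_open.
    * by apply: resolvableI => //; exact/resolvable_open/wcyl_open.
    * by move=> /fP0 ?; apply: fsigmaI => //; exact/fsigma_closed/wcyl_closed.
  + exists ((P0 `&` wcyl u) `|` (X `&` ~` O `&` wcyl u)); split.
    * by move=> w [[/P0X[Xw _] uw]|[[Xw _] uw]].
    * have -> : (X `&` wcyl u) `\` ((P0 `&` wcyl u) `|` (X `&` ~` O `&` wcyl u))
          = ((X `&` O) `\` P0) `&` wcyl u.
        rewrite eqEsubset; split=> [w [[Xw uw] nP]|w [[[Xw Ow] nP] uw]].
          have Ow : O w by apply: contrapT => Ow; apply: nP; right.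
          by split=> //; split=> // Pw; apply: nP; left.
        by split=> // -[[Pw _]|[[_ nO] _]].
      by apply: C_closed => //; exact: wcyl_closed.
    * by apply: gdeltaU => //; apply: gdeltaI => //;
        exact/gdelta_open/wcyl_open.
    * apply: resolvableU; first by apply: resolvableI => //;
        exact/resolvable_open/wcyl_open.
      apply: (resolvableE (S := ~` O `&` wcyl u)).
        by rewrite -[X `&` _ `&` _ in RHS]setIA [RHS]setIA setIid.
      by apply: resolvable_closed; apply: closedI => //; exact: wcyl_closed.
    * move=> fX; apply: fsigmaU; first by apply: fsigmaI;
        [exact: fP0|exact/fsigma_closed/wcyl_closed].
      by rewrite -setIA; apply: fsigmaI => //; apply: fsigma_closed;
        apply: closedI => //; exact: wcyl_closed.
exists P0; move: P0P; rewrite /split_on setIT.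
suff -> : X `&` \bigcup_n W n = X by [].
by apply/setIidPl.
Qed.

End decomposition.

(** A witness K for X is, near some point, contained in P or disjoint from P.
The first is impossible since a relatively closed subset of P is G_delta. *)
Lemma thick_setD C X P :
  thick C X -> resolvable_in X P -> P `<=` X -> gdelta P ->
  thick C (X `\` P).
Proof.
move=> [K [cK XK XKP]] hP PX gP.
have [|x [[Xx Kx] [V /nbhs_cantorP[N NV] AV]]] := hP (X `&` K) _ XK.
  by move=> y [].
case: AV => AV.
  have [|_ []] := XKP x N; first by exists x; split.
  have -> : X `&` K `&` cyl x N = P `&` (K `&` cyl x N).
    rewrite eqEsubset; split=> [y [[Xy Ky] xy]|y [Py [Ky xy]]].
      by split=> //; apply: AV; split=> //; exact: NV.
    by split=> //; split=> //; exact: PX.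
  apply: gdeltaI => //; apply: gdeltaI; first exact: gdelta_closed.
  exact/gdelta_open/cyl_open.
have XPE : (X `\` P) `&` (K `&` cyl x N) = X `&` K `&` cyl x N.
  rewrite eqEsubset; split=> [y [[Xy _] [Ky xy]] //|y [[Xy Ky] xy]].
  split=> //; split=> //; apply: AV; split=> //; exact: NV.
exists (K `&` cyl x N); split.
- by apply: closedI => //; exact: cyl_closed.
- by rewrite XPE; exists x; split.
- move=> y M; rewrite XPE => -[z [[[Xz Kz] xz] yz]].
  have -> : X `&` K `&` cyl x N `&` cyl y M = X `&` K `&` cyl z (maxn N M).
    rewrite -setIA; congr (_ `&` _); rewrite eqEsubset; split=> w.
      move=> [xw yw] i; rewrite leq_max => /orP[iN|iM].
        by rewrite xw// xz.
      by rewrite yw// yz.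
    move=> zw; split.
      by apply: cyl_sub xz _ zw; exact: leq_maxl.
    by apply: cyl_sub yz _ zw; exact: leq_maxr.
  by apply: XKP; exists z; split.
Qed.

(** * Trees of cylinders and closed copies of the model spaces *)

Notation Bs := baire_space.

Lemma nbhs_pairP (T U : discreteTopologicalType)
    (p : prod_topology (fun _ : nat => T) * prod_topology (fun _ : nat => U))
    (V : set ((nat -> T) * (nat -> U))) :
  nbhs p V <-> exists N, forall q, cyl p.1 N q.1 -> cyl p.2 N q.2 -> V q.
Proof.
split=> [[[A W] [/= /nbhs_cylP[N NA] /nbhs_cylP[M MW] AWV]]|[N NV]].
  exists (maxn N M) => q q1 q2; apply: AWV; split.
    by apply: NA; apply: cyl_le q1; exact: leq_maxl.
  by apply: MW; apply: cyl_le q2; exact: leq_maxr.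
exists (cyl p.1 N : set (nat -> T), cyl p.2 N : set (nat -> U)) => /=.
  by split; apply/nbhs_cylP; exists N.
by move=> q /= [q1 q2]; exact: NV.
Qed.

Lemma nbhs_OmBsP (p : Om * Bs) (V : set (Om * Bs)) :
  nbhs p V <-> exists N, forall q, cyl p.1 N q.1 -> cyl p.2 N q.2 -> V q.
Proof. exact: (@nbhs_pairP bool nat). Qed.

Lemma nbhs_OmOmP (p : Om * Om) (V : set (Om * Om)) :
  nbhs p V <-> exists N, forall q, cyl p.1 N q.1 -> cyl p.2 N q.2 -> V q.
Proof. exact: (@nbhs_pairP bool bool). Qed.

Definition agree (m : nat) (p q : Om * Bs) : Prop :=
  forall i, (i < m)%N -> p.1 i = q.1 i /\ p.2 i = q.2 i.

(** This countable set without isolated points serves as a copy of the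
rationals. *)
Definition eventually_true :
  set Om := [set e | exists M, forall m, (M <= m)%N -> e m].

(** With al the set of all naturals, those below two, or zero alone, and ns
true, this is the product of the rationals with the Baire space, with the
Cantor space, or with a point. With ns false the first coordinate is constant
and the first factor disappears. *)
Definition codes (al : pred nat) (ns : bool) : set (Om * Bs) :=
  [set p | [/\ eventually_true p.1, forall m, al (p.2 m)
    & forall m, p.1 m || ns]].

Section scheme.
Variables (al : pred nat) (ns : bool) (X : set Om) (S L : nat -> set Om).
Hypothesis S_closed : forall n, closed (S n).
Hypothesis S_incr : {homo S : m n / (m <= n)%N >-> m `<=` n}.
Hypothesis L_closed : forall n, closed (L n).
Hypothesis XE : forall x, X x <-> (exists n, S n x) /\ forall k, ~ L k x.

Variable big : set Om -> Prop.
Hypothesis big_nonempty : forall P, big P -> P !=set0.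
Hypothesis big_point : forall P, big P ->
  exists2 y, P y & forall N, big (P `&` cyl y N).

(** A node consists of a cylinder (a centre and a length) and the index of the
closed piece of X that is being tracked inside it. *)
Notation state := (Om * nat * nat)%type.
Definition scyl (s : state) : set Om := cyl s.1.1 s.1.2.
Definition sbig (s : state) : Prop := big (X `&` S s.2 `&` scyl s).

Hypothesis branching : forall x N n, sbig (x, N, n) ->
  exists b : nat -> Om * nat, [/\
    forall j, al j -> [/\ (N <= (b j).2)%N, cyl x N (b j).1 & sbig (b j, n)],
    forall j j' z, al j -> al j' -> scyl (b j, n) z -> scyl (b j', n) z ->
      j = j'
  & forall y, X y -> exists N0 j0, forall j z, al j -> j != j0 ->
      cyl y N0 z -> ~ scyl (b j, n) z].
Hypothesis nowhere : ns -> forall s, sbig s ->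
  forall m, exists y, [/\ X y, scyl s y & ~ S m y].
Hypothesis covered : ns -> forall x N, X x -> exists n, sbig (x, N, n).

(** Children are indexed by a symbol j and a bit: with bit true the tracked
piece is kept, with bit false the child leaves S k. All children at level k
leave L k. The last clause says that the family of children is locally finite
at the points of X; it makes the set of limits closed. *)
Definition child_spec (k : nat) (s : state) (c : nat -> bool -> state) : Prop :=
  [/\ forall j b, al j -> b || ns -> [/\ scyl s (c j b).1.1,
          (s.1.2 < (c j b).1.2)%N, sbig (c j b),
          scyl (c j b) `&` L k = set0
        & if b then (c j b).2 = s.2 else scyl (c j b) `&` S k = set0],
      forall j b j' b' z, al j -> b || ns -> al j' -> b' || ns ->
        scyl (c j b) z -> scyl (c j' b') z -> j = j' /\ b = b'
    & forall y, X y -> exists N0 j0, forall j b z, al j -> b || ns -> j != j0 ->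
        cyl y N0 z -> ~ scyl (c j b) z].

(** In each of the branching cylinders, first choose a point of X outside the
tracked piece and S k for the child with bit false; then choose a point of the
tracked piece near which the piece stays big, and a neighbourhood of it
disjoint from the first child. *)
Lemma children k s : sbig s -> exists c, child_spec k s c.
Proof.
case: s => [[x N] n] sb; have [b [b1 b2 b3]] := branching sb.
have avoid (K : set Om) y : closed K -> ~ K y ->
    exists M, forall M', (M <= M')%N -> cyl y M' `&` K = set0.
  move=> cK Ky; have [M MK] := closed_cyl cK Ky; exists M => M' MM'.
  by rewrite -subset0 => z [/(cyl_le MM') /MK].
have /exists_choice[w wP] : forall j, exists w : state, al j -> ns ->
    [/\ cyl (b j).1 (b j).2 w.1.1, ((b j).2 < w.1.2)%N, sbig w,
        scyl w `&` L k = set0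
      & scyl w `&` S k = set0 /\ scyl w `&` S n = set0].
  move=> j; have [jn|jn] := pselect (al j /\ ns); last first.
    by exists (x, 0, 0) => aj nsT; case: jn.
  have [aj nsT] := jn.
  have [_ _ bj] := b1 j aj.
  have [y [Xy yb yS]] := nowhere nsT bj (maxn k n).
  have [|M1 M1P] := avoid (S k) y (@S_closed k).
    by move=> /(S_incr (leq_maxl k n)).
  have [|M2 M2P] := avoid (S n) y (@S_closed n).
    by move=> /(S_incr (leq_maxr k n)).
  have [|M3 M3P] := avoid (L k) y (@L_closed k).
    by have /XE[_] := Xy; exact.
  (* leaving S n as well keeps this child away from the tracked child below *)
  pose M := maxn (b j).2.+1 (maxn M1 (maxn M2 M3)).
  have [n' yn'] := covered nsT M Xy.
  exists (y, M, n') => _ _; split=> //=.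
  - by rewrite /M leq_max leqnn.
  - by apply: M3P; rewrite /M !leq_max leqnn !orbT.
  - by split; [apply: M1P|apply: M2P]; rewrite /M !leq_max leqnn !orbT.
have /exists_choice[v vP] : forall j, exists v : Om * nat, al j ->
    [/\ cyl (b j).1 (b j).2 v.1, ((b j).2 < v.2)%N, sbig (v, n),
        scyl (v, n) `&` L k = set0
      & ns -> scyl (v, n) `&` scyl (w j) = set0].
  move=> j; have [aj|] := pselect (al j); last by exists (x, 0).
  have [_ _ bj] := b1 j aj; have [y [[Xy Sy] yb] By] := big_point bj;
    rewrite /scyl/= in yb.
  have [|M1 M1P] := avoid (L k) y (@L_closed k).
    by have /XE[_] := Xy; exact.
  have [M2 M2P] : exists M, ns -> forall M', (M <= M')%N ->
      cyl y M' `&` scyl (w j) = set0.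
    have [nsT|] := pselect ns; last by exists 0.
    have [_ _ _ _ [_ wS]] := wP j aj nsT.
    have [||M MP] := avoid (scyl (w j)) y; [exact: cyl_closed| |by exists M].
    by move=> yw; move: wS; rewrite -subset0 => /(_ y (conj yw Sy)).
  pose M := maxn (b j).2.+1 (maxn M1 M2).
  have bM : ((b j).2 < M)%N by rewrite /M leq_max leqnn.
  exists (y, M) => _; split=> //=.
  - have := By M; rewrite /sbig/= /scyl/= -setIA; congr (big (_ `&` _)).
    apply/setIidPr; exact: (cyl_sub (ltnW bM) yb).
  - by apply: M1P; rewrite /M !leq_max leqnn !orbT.
  - by move=> nsT; apply: M2P => //; rewrite /M !leq_max leqnn !orbT.
pose c j (t : bool) : state := if t then (v j, n) else w j.
have cb j t : al j -> t || ns -> scyl (c j t) `<=` scyl (b j, n).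
  move=> aj; case: t => /= [_|nsT]; rewrite /scyl.
    by have [? ? _ _ _] := vP j aj; apply: cyl_sub => //; exact: ltnW.
  by have [? ? _ _ _] := wP j aj nsT; apply: cyl_sub => //; exact: ltnW.
exists c; split.
- move=> j t aj tns; have [Nb xb _] := b1 j aj.
  have sb' : cyl (b j).1 (b j).2 `<=` cyl x N by exact: cyl_sub.
  case: t tns => /= [_|nsT].
    have [? ? ? ? _] := vP j aj; split=> //; first exact: sb'.
    by apply: leq_ltn_trans Nb _.
  have [? ? ? ? []] := wP j aj nsT; split=> //; first exact: sb'.
  exact: leq_ltn_trans Nb _.
- move=> j t j' t' z aj tns aj' tns' zc zc'.
  have jj : j = j'.
    by apply: (b2 j j' z) => //; [exact: cb zc|exact: cb zc'].
  split=> //; subst j'.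
  have vw : ns -> ~ (scyl (v j, n) z /\ scyl (w j) z).
    move=> nsT; have [_ _ _ _ /(_ nsT)] := vP j aj; rewrite -subset0 => h zz.
    exact: (h z).
  case: t t' tns tns' zc zc' => [] [] //= tns tns' zc zc'.
    by case: vw.
  by case: vw.
- move=> y /b3[N0 [j0 h]]; exists N0, j0 => j t z aj tns jj yz zc.
  by apply: (h j z) => //; exact: cb zc.
Qed.

Variable s0 : state.
Hypothesis s0_big : sbig s0.

(** The map sends a code to the common point of the cylinders along its branch.
If the bits are eventually true then one piece S n meets all of these cylinders
from some level on, so the limit is in S n. A limit of values in X follows a
unique branch by local finiteness, and the bits along it are eventually true
because the limit is in some S n, which the children with bit false leave at
all levels after n. *)
Lemma scheme : exists h, closed_embedding (codes al ns) X h.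
Proof.
have /exists_choice[ch chP] : forall q : nat * state,
    exists c, sbig q.2 -> child_spec q.1 q.2 c.
  move=> [k s]; have [sb|] := pselect (sbig s).
    by have [c cP] := children k sb; exists c.
  by exists (fun _ _ => s).
pose st := fix st (p : Om * Bs) m := if m is k.+1
  then ch (k, st p k) (p.2 k) (p.1 k) else s0.
pose ok (p : Om * Bs) := (forall m, al (p.2 m)) /\ (forall m, p.1 m || ns).
have st_big p m : ok p -> sbig (st p m).
  move=> [p1 p2]; elim: m => //= m IH.
  by have [/(_ _ _ (p1 m) (p2 m))[]] := chP (m, st p m) IH.
have spec p m : ok p -> child_spec m (st p m) (ch (m, st p m)).
  by move=> /(st_big _ m); exact: (chP (m, st p m)).
have stP p m : ok p -> [/\ scyl (st p m) (st p m.+1).1.1,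
    ((st p m).1.2 < (st p m.+1).1.2)%N, scyl (st p m.+1) `&` L m = set0
    & if p.1 m then (st p m.+1).2 = (st p m).2
      else scyl (st p m.+1) `&` S m = set0].
  move=> okp; have [+ _ _] := spec p m okp; move: (okp) => [p1 p2].
  by move=> /(_ (p.2 m) (p.1 m) (p1 m) (p2 m)) [].
pose h (p : Om * Bs) : Om := fun i => (st p i.+1).1.1 i.
have hst p m : ok p -> scyl (st p m) (h p).
  move=> okp; apply: (@cyl_nested _ (fun m => (st p m).1)) => k.
    by case: (stP p k okp).
  by case: (stP p k okp).
have lst p m : ok p -> (m <= (st p m).1.2)%N.
  move=> okp; elim: m => // m IH; case: (stP p m okp) => _ + _ _.
  exact: leq_ltn_trans.
have st_agree p q m : agree m p q -> st p m = st q m.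
  elim: m => //= m IH pq; rewrite IH; last by move=> i im; apply: pq;
    exact: ltnW.
  by have [-> ->] := pq m (ltnSn m).
have hE p x : ok p -> (forall m, scyl (st p m) x) -> h p = x.
  move=> okp px; apply: funext => i.
  have ii : (i < (st p i.+1).1.2)%N by exact: lst.
  by rewrite (hst p i.+1 okp i ii) (px i.+1 i ii).
have st_inj p q m z : ok p -> ok q ->
    scyl (st p m) z -> scyl (st q m) z -> agree m p q.
  move=> okp okq; elim: m => [|m IH] zp zq; first by move=> i.
  have sub r : ok r -> scyl (st r m.+1) `<=` scyl (st r m).
    by move=> okr; case: (stP r m okr) => ? ? _ _; apply: cyl_sub => //;
      exact: ltnW.
  have pq := IH (sub _ okp _ zp) (sub _ okq _ zq).
  move=> i; rewrite ltnS leq_eqVlt => /predU1P[->|]; last exact: pq.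
  move: zp zq => /=; rewrite (st_agree p q m pq) => zp zq.
  have [_ + _] := spec q m okq; move: okp okq => [p1 p2] [q1 q2].
  by move=> /(_ _ _ _ _ z (p1 m) (p2 m) (q1 m) (q2 m) zp zq) [].
have codes_ok p : codes al ns p -> ok p by move=> [].
have inX p : codes al ns p -> X (h p).
  move=> cp; have okp := codes_ok p cp; apply/XE; split; last first.
    move=> k Lk; case: (stP p k okp) => _ _ + _; rewrite -subset0 => /(_ (h p)).
    by apply; split=> //; exact: hst.
  case: cp => -[M Mp] _ _; exists (st p M).2.
  have trk m : (M <= m)%N -> (st p m).2 = (st p M).2.
    move=> /subnK <-; elim: (m - M)%N => // k <-; rewrite addSn.
    by case: (stP p (k + M) okp) => _ _ _; rewrite Mp ?leq_addl.
  apply: S_closed; apply/closure_cylP => N.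
  have [y [[_ Sy] yst]] := big_nonempty (st_big p (maxn M N) okp).
  exists y; first by rewrite -(trk (maxn M N)) ?leq_maxl.
  apply: (@cyl_le _ _ _ (st p (maxn M N)).1.2).
    by apply: leq_trans (lst p _ okp); exact: leq_maxr.
  exact: cyl_trans (cyl_sym (hst p _ okp)) yst.
exists h; split=> //.
- move=> p cp V /nbhs_cantorP[N NV]; apply/nbhs_OmBsP; exists N => q pq1 pq2 cq.
  apply: NV => i iN; rewrite /h (st_agree q p) // => k ki.
  by split; [apply: pq1|apply: pq2]; exact: leq_ltn_trans iN.
- move=> p q cp cq hpq.
  have pq m : agree m p q.
    apply: (st_inj p q m (h p)); [exact: codes_ok..|exact/hst/codes_ok|].
    by rewrite hpq; exact/hst/codes_ok.
  case: p q pq {cp cq hpq} => p1 p2 [q1 q2] pq.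
  by congr pair; apply: funext => i; have [] := pq i.+1 i (ltnSn i).
- move=> F cF y Xy /closure_cylP ycl.
  have near N : exists p, [/\ codes al ns p, F p & cyl y N (h p)].
    by have [_ [p [cp Fp] <-] yp] := ycl N; exists p.
  (* all codes with value close to y have the same first m symbols *)
  have step m : exists pN : (Om * Bs) * nat, [/\ codes al ns pN.1, F pN.1
      & forall q, codes al ns q -> cyl y pN.2 (h q) -> agree m pN.1 q].
    elim: m => [|m [[p N0] /= [cp Fp pN]]].
      by have [p [cp Fp _]] := near 0; exists (p, 0); split=> // q _ _ i.
    have okp := codes_ok p cp.
    have [_ sd /(_ y Xy) [N1 [j0 slf]]] := spec p m okp.
    set s := st p m in sd slf.
    pose N2 := maxn N0 N1.
    have qN2 q : codes al ns q -> cyl y N2 (h q) -> [/\ agree m p q, q.2 m = j0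
        & scyl (ch (m, s) j0 (q.1 m)) (h q)].
      move=> cq yq; have [q1 q2] := codes_ok q cq.
      have pq : agree m p q.
        by apply: pN => //; apply: cyl_le yq; exact: leq_maxl.
      have hq : scyl (ch (m, s) (q.2 m) (q.1 m)) (h q).
        by have := hst q m.+1 (conj q1 q2); rewrite /= -(st_agree p q m pq).
      have qj : q.2 m = j0.
        apply/eqP/negPn/negP => jj; apply: (slf (q.2 m) (q.1 m) (h q)) => //.
        by apply: cyl_le yq; exact: leq_maxr.
      by split=> //; rewrite -qj.
    (* of the two disjoint cylinders of symbol j0, only one comes close to y *)
    have [t [N3 N3P]] : exists t N3, forall q, codes al ns q ->
        cyl y (maxn N2 N3) (h q) -> q.1 m = t.
      have [yt|yt] := pselect (scyl (ch (m, s) j0 true) y).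
        exists true, (ch (m, s) j0 true).1.2 => q cq yq.
        have [|_ qj hq] := qN2 q cq; first by apply: cyl_le yq; exact: leq_maxl.
        have [q1 q2] := codes_ok q cq.
        have aj0 : al j0 by rewrite -qj.
        have yq' : scyl (ch (m, s) j0 true) (h q).
          by apply: cyl_trans yt _; apply: cyl_le yq; exact: leq_maxr.
        by have [] := sd j0 (q.1 m) j0 true (h q) aj0 (q2 m) aj0 isT hq yq'.
      have [N3 N3P] := closed_cyl (@cyl_closed _ _) yt.
      exists false, N3 => q cq yq.
      have [|_ qj hq] := qN2 q cq; first by apply: cyl_le yq; exact: leq_maxl.
      case E : (q.1 m) hq => // hq; exfalso; apply: (N3P (h q)) => //.
      by apply: cyl_le yq; exact: leq_maxr.
    have [q [cq Fq yq]] := near (maxn N2 N3).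
    have yN2 z : cyl y (maxn N2 N3) z -> cyl y N2 z.
      by apply: cyl_le; exact: leq_maxl.
    exists (q, maxn N2 N3); split=> //= r cr yr i; rewrite ltnS.
    have [pq qj _] := qN2 q cq (yN2 _ yq);
      have [pr rj _] := qN2 r cr (yN2 _ yr).
    rewrite leq_eqVlt => /predU1P[->|im]; first by rewrite qj rj !N3P.
    by have [<- <-] := pq i im; exact: pr.
  have [g gP] := choice step.
  pose p : Om * Bs := (fun i => (g i.+1).1.1 i, fun i => (g i.+1).1.2 i).
  have gg m i q : (i < m)%N -> codes al ns q ->
      cyl y (maxn (g m).2 (g i.+1).2) (h q) -> q.1 i = p.1 i /\ q.2 i = p.2 i.
    move=> im cq yq; have [_ _ gi] := gP i.+1.
    have [|<- <-] // := gi q cq _ i (ltnSn i).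
    by apply: cyl_le yq; exact: leq_maxr.
  have pg m : agree m p (g m).1.
    move=> i im; have [q [cq Fq yq]] := near (maxn (g m).2 (g i.+1).2).
    have [<- <-] := gg m i q im cq yq; have [_ _ gm] := gP m.
    have [|-> ->] // := gm q cq _ i im.
    by apply: cyl_le yq; exact: leq_maxl.
  have okp : ok p.
    by split=> i; have [[_ g1 g2] _ _] := gP i.+1; [exact: g1|exact: g2].
  have yst m : scyl (st p m) y.
    have [q [cq Fq yq]] := near (maxn (g m).2 (st p m).1.2).
    have pq : agree m p q.
      move=> i im; have [-> ->] := pg m i im; have [_ _ gm] := gP m.
      have [|-> ->] // := gm q cq _ i im.
      by apply: cyl_le yq; exact: leq_maxl.
    have := hst q m (codes_ok q cq); rewrite -(st_agree p q m pq) => /cyl_trans.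
    by apply; apply: cyl_sym; apply: cyl_le yq; exact: leq_maxr.
  exists p; last exact: hE.
  split.
    case: (okp) => p1 p2; split=> //.
    have /XE[[n Sn] _] := Xy; exists n => m nm; case E : (p.1 m) => //; exfalso.
    have [_ _ _] := stP p m okp; rewrite E -subset0 => /(_ y); apply.
    by split; [exact: yst|exact: (S_incr nm)].
  apply: cF => V /nbhs_OmBsP[N NV]; exists (g N).1; split.
    by have [] := gP N.
  by apply: NV => i iN; have [] := pg N i iN.
Qed.

End scheme.

Lemma homeo_closed_embedding (T U : topologicalType) (A : set T) (B : set U) f
  r :
  (forall x, A x -> B (f x) /\ r (f x) = x) ->
  (forall y, B y -> A (r y) /\ f (r y) = y) ->
  continuous_on A f -> continuous_on B r -> closed_embedding A B f.
Proof.
move=> fr rf fc rc; split=> //.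
- by move=> x /fr[].
- by move=> x y /fr[_ {2}<-] /fr[_ {2}<-] ->.
- move=> F cF y By ycl; have [Ay fy] := rf _ By; exists (r y) => //.
  split=> //; apply: cF => V /(rc _ By)/ycl [_ [[x [Ax Fx] <-] h]].
  have [Bx rx] := fr _ Ax; exists x; split=> //.
  by rewrite -rx; exact: h.
Qed.

Lemma closed_embedding_relclosed (T : topologicalType) (A K : set T) :
  closed K -> closed_embedding (A `&` K) A id.
Proof.
move=> cK; split; [by move=> x []| |by []|].
  by move=> x _ V /= Vx; apply: filterS Vx => y Vy _.
move=> F cF y Ay ycl; exists y => //; split.
  split=> //; apply: cK => V /ycl[_ [[x [[_ Kx] _] <-] Vx]].
  by exists x.
by apply: cF => V /ycl[_ [[x [_ Fx] <-] Vx]]; exists x.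
Qed.

(** This is the intersection of an F_sigma and a G_delta set, in the form in
which the tree construction uses it. *)
Definition fsigma_cap_gdelta (X : set Om) : Prop := exists S L : nat -> set Om,
  [/\ forall n, closed (S n), {homo S : m n / (m <= n)%N >-> m `<=` n},
      forall n, closed (L n)
    & forall x, X x <-> (exists n, S n x) /\ forall k, ~ L k x].

Lemma fsigma_cap_gdeltaI F G :
  fsigma F -> gdelta G -> fsigma_cap_gdelta (F `&` G).
Proof.
move=> /fsigma_incr[S [cS iS ->]] [L [cL GL]]; exists S, L; split=> // x.
split=> [[[n _ Sx] Gx]|[[n Sx] Lx]].
  split; first by exists n.
  move=> k Lx; have : (\bigcup_n L n) x by exists k.
  by rewrite -GL; exact.
split; first by exists n.
apply: contrapT => nG; have : (~` G) x by [].
by rewrite GL => -[k _ /Lx].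
Qed.

Lemma fsigma_fsigma_cap_gdelta X : fsigma X -> fsigma_cap_gdelta X.
Proof.
move=> fX; rewrite -[X]setIT; apply: fsigma_cap_gdeltaI => //.
exact/gdelta_closed/closedT.
Qed.

Section sigma_ideal.
Variable C : set Om -> Prop.
Hypothesis C_bigcup : forall F : nat -> set Om,
  (forall n, C (F n)) -> C (\bigcup_n F n).
Hypothesis C0 : C set0.

Lemma not_small_nonempty P : ~ C P -> P !=set0.
Proof. by move=> nC; apply/set0P/eqP => P0; apply: nC; rewrite P0. Qed.

(** There are only countably many cylinders. *)
Lemma small_locally P : (forall y, P y -> exists N, C (P `&` cyl y N)) -> C P.
Proof.
move=> PC; pose W n := if unpickle n is Some u then
  (if `[< C (P `&` wcyl u) >] then P `&` wcyl u else set0) else set0.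
have -> : P = \bigcup_n W n.
  rewrite eqEsubset; split=> [y Py|y [n _]]; last first.
    by rewrite /W; case: unpickle => // u; case: asboolP => // _ [].
  have [N yN] := PC y Py; have [u uE] := cyl_word y N.
  exists (pickle u) => //; rewrite /W pickleK asboolT -uE//.
by apply: C_bigcup => n; rewrite /W; case: unpickle => // u; case: asboolP.
Qed.

Lemma not_small_point P : ~ C P ->
  exists2 y, P y & forall N, ~ C (P `&` cyl y N).
Proof.
move=> nC; apply: contrapT => h; apply/nC/small_locally => y Py.
apply: contrapT => /forallNP yN; apply: h; exists y => //.
Qed.

(** This is what a node needs in order to have children: the cylinder b j is
where the children with symbol j are placed. *)
Definition branches (al : pred nat) (X P : set Om) (x : Om) (N : nat) : Prop :=
  exists b : nat -> Om * nat, [/\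
    forall j, al j -> [/\ (N <= (b j).2)%N, cyl x N (b j).1
      & ~ C (P `&` cyl (b j).1 (b j).2)],
    forall j j' z, al j -> al j' -> cyl (b j).1 (b j).2 z ->
      cyl (b j').1 (b j').2 z -> j = j'
  & forall y, X y -> exists N0 j0, forall j z, al j -> j != j0 ->
      cyl y N0 z -> ~ cyl (b j).1 (b j).2 z].

Variable al : pred nat.
Hypothesis branching : forall (X S : set Om) (x : Om) N, closed S ->
  ~ C (X `&` S `&` cyl x N) -> branches al X (X `&` S) x N.

(** The tree lives in the relatively closed part of X given by thickness. That
the nodes with bit false exist is the demand that this part is nowhere G_delta:
a clopen piece of it contained in one closed S m would be G_delta. *)
Lemma thick_closed_embedding X : fsigma_cap_gdelta X -> thick C X ->
  exists h, closed_embedding (codes al true) X h.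
Proof.
move=> [S [L [cS iS cL XE]]] [K [cK [x0 [Xx0 Kx0]] XKP]].
have covered x N : (X `&` K) x ->
    exists n, ~ C (X `&` K `&` (S n `&` K) `&` cyl x N).
  move=> [Xx Kx]; apply: contrapT => /forallNP h.
  have [|+ _] := XKP x N; first by exists x; split.
  apply; have -> : X `&` K `&` cyl x N =
      \bigcup_n (X `&` K `&` (S n `&` K) `&` cyl x N).
    rewrite eqEsubset; split=> [y [[Xy Ky] xy]|y [n _ [[? _] ?]]//].
    by have /XE[[n Sy] _] := Xy; exists n.
  by apply: C_bigcup => n; exact: contrapT.
have [n0 h0] := covered x0 0 (conj Xx0 Kx0).
have [||||||||||h hP] := @scheme al true (X `&` K) (fun n => S n `&` K) L
    _ _ _ _ (fun P => ~ C P) _ _ _ _ _ (x0, 0, n0).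
- by move=> n; exact: closedI.
- by move=> m n mn x [/(iS _ _ mn)].
- exact: cL.
- move=> x; rewrite /setI/=; split=> [[/XE[[n Sx] Lx] Kx]|[[n [Sx Kx]] Lx]].
    by split=> //; exists n.
  by split=> //; apply/XE; split=> //; exists n.
- exact: not_small_nonempty.
- exact: not_small_point.
- move=> x N n sb; have [|b [b1 b2 b3]] := branching _ sb.
    exact: closedI.
  by exists b; split=> //; exact: b1.
- move=> _ s sb m; apply: contrapT => /forallNP h.
  have [y [[[Xy Ky] _] sy]] := not_small_nonempty sb.
  have [|_ +] := XKP s.1.1 s.1.2; first by exists y.
  apply; have -> : X `&` K `&` cyl s.1.1 s.1.2 =
      (~` \bigcup_n L n) `&` (S m `&` K `&` cyl s.1.1 s.1.2).
    rewrite eqEsubset; split=> [z [[Xz Kz] sz]|z [Lz [[Sz Kz] sz]]].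
      have Sz : S m z.
        apply: contrapT => nS; apply: (h z); split=> //.
        by move=> [].
      by split=> //; have /XE[_ Lz] := Xz; move=> [k _ /Lz].
    split=> //; split=> //; apply/XE; split; first by exists m.
    by move=> k Lk; apply: Lz; exists k.
  apply: gdeltaI; first by exists L; rewrite setCK.
  by apply: gdelta_closed; apply: closedI; [exact: closedI|exact: cyl_closed].
- by move=> _ x N; exact: covered.
- exact: h0.
- by exists (id \o h); exact: closed_embedding_comp hP
    (closed_embedding_relclosed _ cK).
Qed.

End sigma_ideal.

Definition is_empty (A : set Om) : Prop := A = set0.

Lemma is_empty_bigcup (F : nat -> set Om) :
  (forall n, is_empty (F n)) -> is_empty (\bigcup_n F n).
Proof. by move=> F0; apply: bigcup0 => n _; exact: F0. Qed.

Definition is_countable (A : set Om) : Prop := countable A.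

Lemma is_countable_bigcup (F : nat -> set Om) :
  (forall n, is_countable (F n)) -> is_countable (\bigcup_n F n).
Proof. by move=> Fc; apply: bigcup_countable => [|n _];
  [exact: countableP|exact: Fc]. Qed.

Lemma branches_one (X P : set Om) (x : Om) N : ~ is_empty (P `&` cyl x N) ->
  branches is_empty (pred1 0) X P x N.
Proof.
move=> nP; exists (fun=> (x, N)); split.
- by move=> j _; split=> //; exact: cyl_refl.
- by move=> j j' z /eqP-> /eqP->.
- by move=> y _; exists 0, 0 => j z /eqP->.
Qed.

(** An uncountable set has two points near which it stays uncountable. *)
Lemma branches_two (X P : set Om) (x : Om) N : ~ is_countable (P `&` cyl x N) ->
  branches is_countable (fun j => (j < 2)%N) X P x N.
Proof.
move=> nP; have [y0 [Py0 xy0] By0] := not_small_point is_countable_bigcup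
  (countable0 _ : is_countable set0) nP.
have nP1 : ~ is_countable ((P `&` cyl x N) `\` [set y0]).
  move=> h; apply: nP; apply: (@sub_countable _ _ _ (((P `&` cyl x N) `\` [set
    y0]) `|` [set y0])).
    apply: subset_card_le => z Pz; have [->|zy] := pselect (z = y0);
      first by right.
    by left.
  have -> : ((P `&` cyl x N) `\` [set y0]) `|` [set y0] =
      \bigcup_n (if n is 0 then (P `&` cyl x N) `\` [set y0] else [set y0]).
    rewrite eqEsubset; split=> [z [h1|h1]|z [[|n] _ h1]]; by
      [exists 0|exists 1|left|right].
  by apply: is_countable_bigcup => -[|n] //; exact: countable1.
have [y1 [[Py1 xy1] y10] By1] := not_small_point is_countable_bigcup
  (countable0 _ : is_countable set0) nP1.
have [i yi] : exists i, y0 i != y1 i.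
  apply: contrapT => /forallNP h; apply: y10; apply: funext => i.
  by apply/esym/eqP/negPn/negP; exact: h.
pose M := maxn N i.+1.
have NM : (N <= M)%N by exact: leq_maxl.
have dis z : cyl y0 M z -> cyl y1 M z -> False.
  have iM : (i < M)%N by exact: leq_maxr.
  by move=> /(_ i iM) z0 /(_ i iM) z1; move: yi; rewrite -z0 -z1 eqxx.
have sub y A : cyl x N y -> A `<=` P -> ~ is_countable (A `&` cyl x N `&` cyl y
  M) ->
    ~ is_countable (P `&` cyl y M).
  move=> xy AP h c; apply: h; apply: sub_countable c; apply: subset_card_le.
  by move=> z [[/AP Pz _] yz].
exists (fun j => (if j == 0 then y0 else y1, M)); split=> /=.
- move=> [|[|//]] _ /=; split=> //; first exact: (sub y0 P xy0 _ (By0 M)).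
  apply: (sub y1 (P `\` [set y0]) xy1); first by move=> z [].
  move=> h; apply: (By1 M); apply: sub_countable h; apply: subset_card_le.
  by move=> z [[[Pz xz] zy] yz].
- by move=> [|[|//]] [|[|//]] z //= _ _ z0 z1; case: (dis z).
- move=> y _; exists M, (if `[< cyl y0 M y >] then 0 else 1).
  move=> [|[|//]] z _ /= + yz; case: asboolP => // y0y _ h.
    by apply: y0y; apply: cyl_trans h _; exact: cyl_sym.
  by apply: (dis y) => //; apply: cyl_trans h _; exact: cyl_sym.
Qed.

Lemma fsigma_bigcup (F : nat -> set Om) :
  (forall n, fsigma (F n)) -> fsigma (\bigcup_n F n).
Proof. exact: (@fsigma_countbigcup nat). Qed.

Lemma fsigma0 : fsigma set0. Proof. exact/fsigma_closed/closed0. Qed.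

(** Let P' be the set of points near which P is not F_sigma. If P' were closed
then P would be F_sigma, so P' has an accumulation point z outside P', and z is
not in X. The first level at which a point of P' leaves z takes arbitrarily
large values, and the cylinders of points with different leaving levels are
disjoint and accumulate only at z. *)
Lemma branches_omega (X S : set Om) (x : Om) N :
  closed S -> ~ fsigma (X `&` S `&` cyl x N) ->
  branches fsigma predT X (X `&` S) x N.
Proof.
set P := X `&` S `&` cyl x N => cS nP.
pose P' := [set y | P y /\ forall M, ~ fsigma (P `&` cyl y M)].
have [z [zP' nz]] : exists z, closure P' z /\ ~ P' z.
  apply: contrapT => h; apply: nP.
  have cP' : closed P'.
    by move=> z zP'; apply: contrapT => nz; apply: h; exists z.
  have -> : P = P' `|` (P `&` ~` P').
    rewrite eqEsubset; split=> [y Py|y [[]|[]]//].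
    by have [h'|h'] := pselect (P' y); [left|right].
  apply: fsigmaU; first exact: fsigma_closed.
  apply: (small_locally fsigma_bigcup fsigma0) => y [Py nP'].
  have /existsNP[M /contrapT fM] : ~ forall M, ~ fsigma (P `&` cyl y M).
    by move=> h'; apply: nP'.
  exists M; have -> : P `&` ~` P' `&` cyl y M = P `&` cyl y M `&` ~` P'.
    by rewrite setIAC.
  by apply: fsigmaI => //; apply: fsigma_open; exact: closed_openC.
have Xz : ~ X z.
  move=> Xz; apply: nz; split.
    split; last first.
      apply: (@cyl_closed x N) => V /zP'[y [[[_ xy] _] Vy]].
      by exists y.
    split=> //; apply: cS => V /zP'[y [[[[_ Sy] _] _] Vy]]; by exists y.
  move=> M; have /closure_cylP/(_ M) [y [_ yP] zy] := zP'.
  have -> : cyl z M = cyl y M; last exact: yP.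
  rewrite eqEsubset; split=> w; last exact: cyl_trans.
  exact/cyl_trans/cyl_sym.
have diff w : w <> z -> exists i, cyl z i w /\ w i != z i.
  move=> wz; have ex : exists i, w i != z i.
    apply: contrapT => /forallNP h; apply: wz; apply: funext => i.
    by apply/eqP/negPn/negP; exact: h.
  have := find_ex_minn ex => -[i wi mi]; exists i; split=> // k ki.
  by apply/eqP; apply: contraTT ki => /mi; rewrite leqNgt.
have /exists_choice[g gP] : forall M, exists yi : Om * nat,
    [/\ P' yi.1, cyl z yi.2 yi.1, yi.1 yi.2 != z yi.2 & (M <= yi.2)%N].
  move=> M; have /closure_cylP/(_ M) [y yP zy] := zP'.
  have [|i [zi yi]] := diff y.
    by move=> yz; apply: Xz; case: yP => -[[Xy _] _] _; rewrite -yz.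
  exists (y, i); split=> //=; rewrite leqNgt; apply/negP => iM.
  by move: yi; rewrite zy// eqxx.
(* points of P' with increasing leaving levels (c j).2 *)
pose c := fix c j := if j is k.+1 then g (c k).2.+1 else g N.
have cP j : [/\ P' (c j).1, cyl z (c j).2 (c j).1, (c j).1 (c j).2 != z (c j).2
    & (N <= (c j).2)%N].
  elim: j => [|j [_ _ _ IH]] /=; first exact: gP.
  by have [? ? ? ij] := gP (c j).2.+1; split=> //;
    exact: leq_trans IH (ltnW ij).
have cS' j : ((c j).2 < (c j.+1).2)%N by have [_ _ _] := gP (c j).2.+1.
have c_lt j k : (j < k)%N -> ((c j).2 < (c k).2)%N.
  by move=> jk; elim: k jk => // k IH; rewrite ltnS leq_eqVlt =>
    /predU1P[->//|/IH/ltn_trans]; apply.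
have c_inj j k : (c j).2 = (c k).2 -> j = k.
  move=> jk; have [/c_lt|/c_lt|//] := ltngtP j k; by rewrite jk ltnn.
(* a point of the j-th cylinder leaves z exactly at level (c j).2 *)
have bE j w : cyl (c j).1 (c j).2.+1 w ->
  cyl z (c j).2 w /\ w (c j).2 != z (c j).2.
  have [_ zc zn _] := cP j => cw; split; last by rewrite cw.
  by apply: cyl_trans zc _; apply: cyl_le cw.
have leave w i i' : cyl z i w -> w i != z i -> cyl z i' w -> w i' != z i' ->
    i = i'.
  move=> wi ni wi' ni'; have [ii|ii|//] := ltngtP i i'.
    by move: ni; rewrite wi' ?eqxx.
  by move: ni'; rewrite wi ?eqxx.
exists (fun j => ((c j).1, (c j).2.+1)); split=> /=.
- move=> j _; have [[[[Xc Sc] xc] nc] zc zn Nc] := cP j.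
  split=> //; first exact: ltnW.
  have -> : X `&` S `&` cyl (c j).1 (c j).2.+1 = P `&` cyl (c j).1 (c j).2.+1.
    rewrite /P -[RHS]setIA; congr (_ `&` _); apply/esym/setIidPr.
    by apply: cyl_sub xc; exact: ltnW.
  exact: nc.
- move=> j k w _ _ /bE[w1 w2] /bE[w3 w4]; apply: c_inj;
    exact: leave w1 w2 w3 w4.
- move=> y Xy; have [|i [zy yi]] := diff y; first by move=> yz; apply: Xz;
    rewrite -yz.
  exists i.+1.
  have [[j0 j0i]|nj] := pselect (exists j, (c j).2 = i).
    exists j0 => j w _ jj yw /bE[w1 w2]; move/eqP: jj; apply; apply: c_inj.
    rewrite j0i; apply: (leave w) => //.
      by apply: cyl_trans zy _; apply: cyl_le yw.
    by rewrite yw.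
  exists 0 => j w _ _ yw /bE[w1 w2]; apply: nj; exists j;
    apply: (leave w) => //.
    by apply: cyl_trans zy _; apply: cyl_le yw.
  by rewrite yw.
Qed.

Lemma pair_continuous_on (T U W : topologicalType) (A : set T) (f : T ->
  U) (g : T -> W) :
  continuous_on A f -> continuous_on A g ->
    continuous_on A (fun x => (f x, g x)).
Proof.
move=> fc gc x Ax V [[P Q] [/= /(fc x Ax) fP /(gc x Ax) gQ] PQV].
by apply: filterS2 fP gQ => y yP yQ Ay; apply: PQV; split;
  [exact: yP|exact: yQ].
Qed.

Lemma id_continuous_on (T : topologicalType) (A : set T) :
  continuous_on A (fun x => x).
Proof. by move=> x _ V Vx; apply: filterS Vx => y Vy _. Qed.

Lemma cst_continuous_on (T U : topologicalType) (A : set T) (u : U) :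
  continuous_on A (fun=> u).
Proof.
by move=> x _ V Vx; apply: filterE => y _; exact: (nbhs_singleton Vx).
Qed.

Lemma fst_continuous_on (T U : topologicalType) (A : set (T * U)) :
  continuous_on A fst.
Proof. by apply: continuous_on_total => x; exact: cvg_fst. Qed.

Lemma snd_continuous_on (T U : topologicalType) (A : set (T * U)) :
  continuous_on A snd.
Proof. by apply: continuous_on_total => x; exact: cvg_snd. Qed.

Definition om_bs (x : Om) : Bs := fun i => nat_of_bool (x i).
Definition bs_om (a : Bs) : Om := fun i => a i == 1.

Lemma om_bs_continuous : continuous om_bs.
Proof.
move=> x V /nbhs_baireP[N NV]; apply/nbhs_cantorP; exists N => y xy.
by apply: NV => i iN; rewrite /om_bs xy.
Qed.

Lemma bs_om_continuous : continuous bs_om.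
Proof.
move=> x V /nbhs_cantorP[N NV]; apply/nbhs_baireP; exists N => y xy.
by apply: NV => i iN; rewrite /bs_om xy.
Qed.

Lemma om_bsK : cancel om_bs bs_om.
Proof. by move=> x; apply: funext => i; rewrite /bs_om/om_bs; case: (x i). Qed.

Lemma bs_omK a : (forall i, (a i < 2)%N) -> om_bs (bs_om a) = a.
Proof.
by move=> a2; apply: funext => i; rewrite /bs_om/om_bs;
  case: (a i) (a2 i) => [|[|]].
Qed.

Section targets.
Variable X : set Om.

Lemma thick_empty_closed_embedding : fsigma_cap_gdelta X -> thick is_empty X ->
  exists h, closed_embedding eventually_true X h.
Proof.
move=> sX tX.
have [|h hP] := thick_closed_embedding is_empty_bigcup (erefl : is_empty set0)
    (al := pred1 0) _ sX tX.
  by move=> X' S x N _; exact: branches_one.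
exists (h \o (fun e : Om => (e, (fun=> 0) : Bs)));
  apply: closed_embedding_comp hP.
apply: (@homeo_closed_embedding _ _ _ _ _ fst).
- by move=> e ee; split=> //; split=> // m; rewrite orbT.
- move=> [e a] [/= ee a0 _]; split=> //; congr pair; apply: funext => i.
  by rewrite (eqP (a0 i)).
- apply: pair_continuous_on; first exact: id_continuous_on.
  exact: cst_continuous_on.
- exact: fst_continuous_on.
Qed.

Lemma thick_countable_closed_embedding :
  fsigma_cap_gdelta X -> thick is_countable X ->
  exists h, closed_embedding (eventually_true `*` [set: Om]) X h.
Proof.
move=> sX tX.
have [|h hP] := thick_closed_embedding is_countable_bigcup (countable0 _ :
  is_countable set0)
    (al := fun j => (j < 2)%N) _ sX tX.
  by move=> X' S x N _; exact: branches_two.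
exists (h \o (fun p => (p.1, om_bs p.2))); apply: closed_embedding_comp hP.
apply: (@homeo_closed_embedding _ _ _ _ _ (fun p => (p.1, bs_om p.2))).
- move=> [e x] [/= ee _]; rewrite om_bsK; split=> //; split=> // m.
    by rewrite /om_bs/=; case: (x m).
  by rewrite orbT.
- move=> [e a] [/= ee a0 _]; split=> //; congr pair; exact: bs_omK.
- apply: pair_continuous_on; first exact: fst_continuous_on.
  apply: (continuous_on_comp (B := setT) _ (@snd_continuous_on _ _ _)) => //.
  exact/continuous_on_total/om_bs_continuous.
- apply: pair_continuous_on; first exact: fst_continuous_on.
  apply: (continuous_on_comp (B := setT) _ (@snd_continuous_on _ _ _)) => //.
  exact/continuous_on_total/bs_om_continuous.
Qed.

Lemma thick_fsigma_closed_embedding : fsigma_cap_gdelta X -> thick fsigma X ->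
  exists h, closed_embedding (eventually_true `*` [set: Bs]) X h.
Proof.
move=> sX tX; have [|h hP] := thick_closed_embedding fsigma_bigcup fsigma0 (al
  := predT) _ sX tX.
  by move=> X' S x N; exact: branches_omega.
exists h; have -> : eventually_true `*` [set: Bs] = codes predT true;
  last exact: hP.
rewrite eqEsubset; split=> [[e a] [/= ee _]|[e a] [ee _ _]]; last by split.
by split=> // m; rewrite orbT.
Qed.

Lemma closed_uncountable_closed_embedding : closed X -> ~ countable X ->
  exists h, closed_embedding [set: Om] X h.
Proof.
move=> cX nX.
have [||||||||||h hP] := @scheme (fun j => (j < 2)%N) false X (fun=> X)
    (fun=> set0) _ _ _ _ (fun P => ~ is_countable P) _ _ _ _ _ ((fun=> false) :
      Om, 0, 0).
- by move=> _; exact: cX.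
- by move=> m n _ x.
- by move=> _; exact: closed0.
- by move=> x; split=> [Xx|[[] //]]; split; [exists 0|move=> _].
- exact: not_small_nonempty (countable0 _ : is_countable set0).
- exact: not_small_point is_countable_bigcup (countable0 _ : is_countable set0).
- move=> x N n sb; have [b [b1 b2 b3]] := branches_two X sb.
  by exists b; split=> //; exact: b1.
- by [].
- by [].
- rewrite /sbig/scyl/= setIid; have -> // : X `&` cyl (fun=> false) 0 = X.
  by apply/setIidPl => x _ i.
exists (h \o (fun x => ((fun=> true) : Om, om_bs x)));
  apply: closed_embedding_comp hP.
apply: (@homeo_closed_embedding _ _ _ _ _ (fun p => bs_om p.2)).
- move=> x _; rewrite om_bsK; split=> //; split=> //; first by exists 0.
  by move=> m; rewrite /om_bs/=; case: (x m).
- move=> [e a] [/= ee a0 e1]; split=> //; congr pair; last exact: bs_omK.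
  by apply: funext => i; have := e1 i; rewrite orbF.
- apply: pair_continuous_on; last exact/continuous_on_total/om_bs_continuous.
  exact: cst_continuous_on.
- apply: (continuous_on_comp (B := setT) _ (@snd_continuous_on _ _ _)) => //.
  exact/continuous_on_total/bs_om_continuous.
Qed.

Lemma gdelta_not_fsigma_closed_embedding :
  gdelta X -> ~ fsigma X -> exists h, closed_embedding [set: Bs] X h.
Proof.
move=> [L [cL XL]] nX.
have [||||||||||h hP] := @scheme predT false X (fun=> setT) L
    _ _ _ _ (fun P => ~ fsigma P) _ _ _ _ _ ((fun=> false) : Om, 0, 0).
- by move=> _; exact: closedT.
- by [].
- exact: cL.
- move=> x; split=> [Xx|[_ Lx]].
    by split; [exists 0|move=> k Lk; have : (~` X) x by rewrite XL; exists k].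
  by apply: contrapT => nXx; have : (~` X) x by []; rewrite XL => -[k _ /Lx].
- exact: not_small_nonempty fsigma0.
- exact: not_small_point fsigma_bigcup fsigma0.
- move=> x N n sb; have [b [b1 b2 b3]] := branches_omega closedT sb.
  by exists b; split=> //; exact: b1.
- by [].
- by [].
- rewrite /sbig/scyl/= setIT; have -> // : X `&` cyl (fun=> false) 0 = X.
  by apply/setIidPl => x _ i.
exists (h \o (fun a => ((fun=> true) : Om, a)));
  apply: closed_embedding_comp hP.
apply: (@homeo_closed_embedding _ _ _ _ _ snd).
- by move=> x _; split=> //; split=> //; exists 0.
- move=> [e a] [/= ee a0 e1]; split=> //; congr pair.
  by apply: funext => i; have := e1 i; rewrite orbF.
- apply: pair_continuous_on; first exact: cst_continuous_on.
  exact: id_continuous_on.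
- exact: snd_continuous_on.
Qed.

End targets.

(** * Closed embeddings in the model spaces *)

Definition least (Q : set nat) : nat :=
  if pselect (exists n, `[< Q n >]) is left e then ex_minn e else 0.

Lemma leastP (Q : set nat) n : Q n -> Q (least Q) /\ (least Q <= n)%N.
Proof.
move=> Qn; rewrite /least; case: pselect => [e|[]]; last by exists n;
  apply/asboolP.
by case: ex_minnP => m /asboolP Qm h; split=> //; apply/h/asboolP.
Qed.

Lemma least_unique (Q : set nat) n : Q n -> (forall k, Q k -> (n <= k)%N) ->
  least Q = n.
Proof.
move=> Qn nQ; have [Ql ln] := leastP Qn; apply/eqP.
by rewrite eqn_leq ln /=; exact: nQ.
Qed.

Section level_code.
Variable S : nat -> set Om.

Definition meets (x : Om) (m : nat) : set nat :=
  [set n | exists2 y, S n y & cyl x m y].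

(** Bit m tells whether the first of the closed sets that meets the cylinder of
length m around x still meets the cylinder of length m+1. *)
Definition stays (x : Om) : Om :=
  fun m => `[< meets x m.+1 (least (meets x m)) >].

Lemma meets_cyl x y m : cyl x m y -> meets x m = meets y m.
Proof.
move=> xy; rewrite eqEsubset; split=> n [z Sz h]; exists z => //.
  exact: cyl_trans (cyl_sym xy) h.
exact: cyl_trans xy h.
Qed.

Lemma meetsS x m n : meets x m.+1 n -> meets x m n.
Proof. by move=> [y Sy xy]; exists y => //; exact: cyl_le xy. Qed.

Lemma stays_cyl x y m : cyl x m.+1 y -> stays y m = stays x m.
Proof.
move=> xy; have xy' : cyl x m y by exact: cyl_le xy.
by rewrite /stays (meets_cyl xy) (meets_cyl xy').
Qed.

Lemma stays_continuous : continuous stays.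
Proof.
move=> x V /nbhs_cantorP[N NV]; apply/nbhs_cantorP; exists N => y xy.
by apply: NV => i iN; apply: stays_cyl; exact: cyl_le xy.
Qed.

Hypothesis S_closed : forall n, closed (S n).

(** The index of the first closed set that meets the cylinder of length m is
nondecreasing in m. It is bounded when x is in the union; and if it is constant
from some level on, then x is in the set with this index, which is closed. *)
Lemma eventually_true_stays x : eventually_true (stays x) <-> (\bigcup_n S n) x.
Proof.
split=> [[M Mx]|[i _ Si]].
  exists (least (meets x M)) => //; apply: S_closed; apply/closure_cylP => N.
  have lE m : (M <= m)%N -> least (meets x m) = least (meets x M)
      /\ meets x m.+1 (least (meets x M)).
    move=> /subnK <-; elim: (m - M)%N => [|k [IH1 IH2]].
      by split=> //; apply/asboolP/Mx.
    rewrite addSn; have E : least (meets x (k + M).+1) = least (meets x M).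
      apply: least_unique => // j /meetsS /leastP[_].
      by rewrite IH1.
    split=> //; rewrite -E; apply/asboolP; apply: (Mx (k + M).+1).
    by rewrite -addSn leq_addl.
  have [_ [y Sy xy]] := lE (maxn M N) (leq_maxl _ _); exists y => //.
  by apply: cyl_le xy; rewrite ltnW// ltnS leq_maxr.
have mi m : meets x m i by exists x.
have lmono m : (least (meets x m) <= least (meets x m.+1))%N.
  have [h _] := leastP (mi m.+1).
  by have [] := leastP (meetsS h).
have ex : exists n, `[< exists m, least (meets x m) = n >].
  by exists (least (meets x 0)); apply/asboolP; exists 0.
have bd n : `[< exists m, least (meets x m) = n >] -> (n <= i)%N.
  by move=> /asboolP[m <-]; have [] := leastP (mi m).
case: (ex_maxnP ex bd) => n /asboolP[M Mn] nmax; exists M => m Mm.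
have lE k : (M <= k)%N -> least (meets x k) = n.
  move=> Mk; apply/eqP; rewrite eqn_leq nmax /=; last by apply/asboolP;
    exists k.
  move: Mk => /subnK <-; elim: (k - M)%N => [|j IH]; first by rewrite Mn.
  by rewrite addSn; exact: leq_trans IH (lmono _).
apply/asboolP; rewrite (lE m Mm) -(lE m.+1); last exact: leq_trans Mm _.
by have [] := leastP (mi m.+1).
Qed.

End level_code.

(** If the tracked set is a single point, then staying means that the next bit
of x agrees with that of the point, so x can be reconstructed from its code. *)
Lemma stays_inj (f : nat -> Om) (x y : Om) : closure (range f) x ->
  closure (range f) y ->
  stays (fun n => [set f n]) x = stays (fun n => [set f n]) y -> x = y.
Proof.
move=> cx cy xy; suff h m : cyl x m y.
  by apply: funext => i; rewrite (h i.+1 i).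
elim: m => [|m IH]; first by move=> i.
have [n mn] : exists n, meets (fun n => [set f n]) x m n.
  by have /closure_cylP/(_ m)[_ [n _ <-] xf] := cx; exists n, (f n).
have [[_ -> xl] _] := leastP mn; set l := least _ in xl.
have stE z : cyl z m x -> stays (fun n => [set f n]) z m = (f l m == z m).
  move=> zx; rewrite /stays (meets_cyl _ zx) -/l.
  apply/asboolP/eqP => [[_ -> /(_ m (ltnSn m))//]|fz].
  exists (f l) => //; apply: cylS => //; exact: cyl_trans zx xl.
apply: cylS => //; have := congr1 (fun e => e m) xy; rewrite !stE//;
  last exact: cyl_sym.
by case: (f l m); case: (x m); case: (y m).
Qed.

Lemma closed_embedding_set0 (T U : topologicalType) (B : set U) (f : T -> U) :
  closed_embedding set0 B f.
Proof.
split=> // F cF y By; rewrite set0I image_set0 => /(_ setT filterT) [? []//].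
Qed.

(** The code is continuous and injective on the compact closure of X, hence a
closed map there, and X is the preimage of eventually_true in this closure. *)
Lemma countable_closed_embedding (X : set Om) :
  countable X -> exists f, closed_embedding X eventually_true f.
Proof.
move=> Xc; have [->|/set0P/(countable_range Xc)[g ->]] := eqVneq X set0.
  by exists id; exact: closed_embedding_set0.
have rg : range g = \bigcup_n [set g n].
  by rewrite eqEsubset; split=> [x [n _ <-]|x [n _ ->]]; exists n.
pose S n : set Om := [set g n].
have Sc n : closed (S n) by exact: cantor_closed1.
exists (stays S); split.
- by move=> x; rewrite rg => /(eventually_true_stays Sc).
- exact/continuous_on_total/stays_continuous.
- by move=> x y gx gy; apply: stays_inj; exact: subset_closure.
- move=> F cF e ee ecl.
  have cp : compact (stays S @` (closure (range g) `&` F)).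
    apply: continuous_compact.
      by apply: continuous_subspaceT; exact: stays_continuous.
    apply: (subclosed_compact _ cantor_space_compact) => //.
    by apply: closedI => //; exact: closed_closure.
  have [x [gx Fx] xe] : (stays S @` (closure (range g) `&` F)) e.
    apply: (compact_closed cantor_space_hausdorff cp).
    by apply: closureS ecl => _ [x [gx Fx] <-]; exists x => //; split=> //;
      exact: subset_closure.
  exists x => //; split=> //; rewrite rg; apply/(eventually_true_stays Sc).
  by rewrite xe.
Qed.

(** Pairing with the identity makes the code injective on the whole Cantor
space. *)
Lemma fsigma_closed_embedding X :
  fsigma X -> exists f, closed_embedding X (eventually_true `*` [set: Om]) f.
Proof.
move=> [S [Sc ->]]; exists (fun x => (stays S x, x)); split.
- by move=> x Sx; split=> //; exact/(eventually_true_stays Sc).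
- apply: pair_continuous_on; first exact/continuous_on_total/stays_continuous.
  exact: id_continuous_on.
- by move=> x y _ _ [].
- move=> F cF [e x] [/= ee _] ecl.
  have near N : exists y, [/\ F y, cyl e N (stays S y) & cyl x N y].
    have [|_ [[y [_ Fy] <-] /= [h1 h2]]] :=
      ecl [set q | cyl e N q.1 /\ cyl x N q.2].
      by apply/nbhs_OmOmP; exists N.
    by exists y.
  have ex : stays S x = e.
    apply: funext => i; have [y [_ ey xy]] := near i.+1.
    by rewrite -(stays_cyl _ xy) ey.
  exists x; last by rewrite ex.
  split; first by apply/(eventually_true_stays Sc); rewrite ex.
  by apply: cF; apply/closure_cylP => N; have [y [? _ ?]] := near N; exists y.
Qed.

Section gdelta_code.
Variable L : nat -> set Om.
Hypothesis L_closed : forall n, closed (L n).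

Definition avoids (x : Om) (m : nat) : set nat :=
  [set N | cyl x N `&` L m = set0].

(** The m-th value packs the m-th bit of x, as parity, with the length of the
first cylinder around x that avoids L m. A convergent sequence of codes keeps
this length bounded, so its limit avoids L m as well. *)
Definition gcode (x : Om) : Bs := fun m => ((least (avoids x m)).*2 + x m)%N.

Let G : set Om := [set x | forall k, ~ L k x].

Lemma odd_gcode x m : odd (gcode x m) = x m.
Proof. by rewrite /gcode oddD odd_double /=; case: (x m). Qed.

Lemma half_gcode x m : (gcode x m)./2 = least (avoids x m).
Proof. by rewrite /gcode addnC half_bit_double. Qed.

Lemma avoids_least x m : G x -> avoids x m (least (avoids x m)).
Proof.
move=> Gx; have [N xN] := closed_cyl (@L_closed m) (Gx m).
have : avoids x m N by rewrite /avoids/= -subset0 => y [/xN].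
by move=> /leastP[].
Qed.

Lemma avoids_cyl x y m N : cyl x N y -> avoids x m N ->
  (forall k, avoids x m k -> (N <= k)%N) -> least (avoids y m) = N.
Proof.
have cE k : (k <= N)%N -> cyl x N y -> cyl x k = cyl y k.
  move=> kN /(cyl_le kN) xy; rewrite eqEsubset; split=> z;
    last exact: cyl_trans.
  exact/cyl_trans/cyl_sym.
move=> xy xN Nmin; apply: least_unique; first by rewrite /avoids/= -(cE N).
move=> k yk; rewrite leqNgt; apply/negP => kN.
by have := Nmin k; rewrite /avoids/= (cE k (ltnW kN) xy) leqNgt kN => /(_ yk).
Qed.

Lemma gcode_cyl x y m : G x -> cyl x (maxn m.+1 (least (avoids x m))) y ->
  gcode y m = gcode x m.
Proof.
move=> Gx xy; rewrite /gcode.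
have -> : y m = x m by apply: xy; rewrite leq_max leqnn.
have -> // : least (avoids y m) = least (avoids x m).
apply: (@avoids_cyl x); first by apply: cyl_le xy; exact: leq_maxr.
  exact: avoids_least.
by move=> k /leastP[].
Qed.

Lemma gcode_continuous_on : continuous_on G gcode.
Proof.
move=> x Gx V /nbhs_baireP[N NV]; apply/nbhs_cantorP.
exists (\max_(m < N) maxn m.+1 (least (avoids x m))) => y xy _.
apply: NV => i iN; apply: gcode_cyl => //; apply: cyl_le xy.
exact: (leq_bigmax (Ordinal iN)).
Qed.

Lemma gcode_closed_embedding : closed_embedding G [set: Bs] gcode.
Proof.
split=> //; first exact: gcode_continuous_on.
  move=> x y _ _ xy; apply: funext => i.
  by rewrite -odd_gcode xy odd_gcode.
move=> F cF b _ bcl.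
have near N : exists x, [/\ G x, F x & cyl b N (gcode x)].
  have [|_ [[x [Gx Fx] <-] h]] := bcl (cyl b N); last by exists x.
  by apply/nbhs_baireP; exists N.
pose x : Om := fun i => odd (b i).
have nearx N : exists y, [/\ G y, F y, cyl b N (gcode y) & cyl x N y].
  have [y [Gy Fy by_]] := near N; exists y; split=> // i iN.
  by rewrite -odd_gcode by_.
have xL m : avoids x m (b m)./2 /\ least (avoids x m) = (b m)./2.
  have [y [Gy Fy by_ xy]] := nearx (maxn m.+1 (b m)./2).
  have ym : least (avoids y m) = (b m)./2.
    by rewrite -half_gcode by_// leq_max leqnn.
  have yx : cyl y (b m)./2 x.
    by apply: cyl_sym; apply: cyl_le xy; exact: leq_maxr.
  have yL := avoids_least m Gy; rewrite ym in yL; split.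
    rewrite /avoids/=; have <- // : cyl y (b m)./2 = cyl x (b m)./2.
    rewrite eqEsubset; split=> z; last exact: cyl_trans.
    exact/cyl_trans/cyl_sym.
  by apply: (avoids_cyl yx yL) => k /leastP[_]; rewrite ym.
have Gx : G x.
  move=> m Lx; have [+ _] := xL m; rewrite /avoids/= -subset0 => /(_ x).
  by apply; split.
exists x.
  split=> //; apply: cF; apply/closure_cylP => N.
  by have [y [? ? ? ?]] := nearx N; exists y.
apply: funext => m; rewrite /gcode; have [_ ->] := xL m.
by rewrite addnC; exact: odd_double_half.
Qed.

End gdelta_code.

Lemma gdelta_closed_embedding X :
  gdelta X -> exists f, closed_embedding X [set: Bs] f.
Proof.
move=> [L [cL XL]]; exists (gcode L).
have -> : X = [set x | forall k, ~ L k x]; last exact: gcode_closed_embedding.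
rewrite eqEsubset; split=> [x Xx k Lk|x Lx].
  by have : (~` X) x by rewrite XL; exists k.
by apply: contrapT => nX; have : (~` X) x by []; rewrite XL => -[k _ /Lx].
Qed.

Lemma fsigma_cap_gdelta_closed_embedding X :
  fsigma_cap_gdelta X ->
    exists f, closed_embedding X (eventually_true `*` [set: Bs]) f.
Proof.
move=> [S [L [cS iS cL XE]]].
have [_ gc _ gcl] := gcode_closed_embedding cL.
have XG x : X x -> forall k, ~ L k x by move=> /XE[].
exists (fun x => (stays S x, gcode L x)); split.
- move=> x /XE[[n Sx] _]; split=> //; apply/(eventually_true_stays cS);
    by exists n.
- apply: pair_continuous_on; first exact/continuous_on_total/stays_continuous.
  exact: continuous_onS gc.
- move=> x y _ _ [_ xy]; apply: funext => i.
  by rewrite -(odd_gcode L) xy odd_gcode.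
- move=> F cF [e b] [/= ee _] ecl.
  have near N : exists y, [/\ X y, F y, cyl e N (stays S y) & cyl b N (gcode L
    y)].
    have [|_ [[y [Xy Fy] <-] /= [h1 h2]]] :=
      ecl [set q | cyl e N q.1 /\ cyl b N q.2].
      by apply/nbhs_OmBsP; exists N.
    by exists y.
  have [//||x [Gx Fx] xb] := gcl F cF b.
    move=> V /nbhs_baireP[N NV]; have [y [Xy Fy _ by_]] := near N.
    exists (gcode L y); split; last exact: NV.
    by exists y => //; split=> //; exact: XG.
  have xe : stays S x = e.
    apply: funext => i; have [y [_ _ ey by_]] := near i.+1.
    rewrite -ey// -(@stays_cyl S y x)// => k ki.
    by rewrite -(odd_gcode L x) xb -by_// odd_gcode.
  exists x; last by rewrite xe xb.
  split=> //; apply/XE; split=> //.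
  have : eventually_true (stays S x) by rewrite xe.
  by move=> /(eventually_true_stays cS) [n _ Sx]; exists n.
Qed.

(** * Weak homeomorphism types of subsets of the Cantor space *)

Section classification.
Variable X : set Om.

Lemma weakly_homeo_rationals :
  countable X -> thick is_empty X -> weakly_homeo X eventually_true.
Proof.
move=> cX tX; have [f fP] := countable_closed_embedding cX.
have [g gP] := thick_empty_closed_embedding (fsigma_fsigma_cap_gdelta
  (fsigma_countable cX)) tX.
exact: weakly_homeo_closed_embedding fP gP.
Qed.

Lemma weakly_homeo_rationals_cantor : fsigma X -> thick is_countable X ->
  weakly_homeo X (eventually_true `*` [set: Om]).
Proof.
move=> cX tX; have [f fP] := fsigma_closed_embedding cX.
have [g gP] := thick_countable_closed_embedding (fsigma_fsigma_cap_gdelta cX)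
  tX.
exact: weakly_homeo_closed_embedding fP gP.
Qed.

Lemma weakly_homeo_rationals_baire : fsigma_cap_gdelta X -> thick fsigma X ->
  weakly_homeo X (eventually_true `*` [set: Bs]).
Proof.
move=> cX tX; have [f fP] := fsigma_cap_gdelta_closed_embedding cX.
have [g gP] := thick_fsigma_closed_embedding cX tX.
exact: weakly_homeo_closed_embedding fP gP.
Qed.

Lemma weakly_homeo_baire : gdelta X -> ~ fsigma X -> weakly_homeo X [set: Bs].
Proof.
move=> cX tX; have [f fP] := gdelta_closed_embedding cX.
have [g gP] := gdelta_not_fsigma_closed_embedding cX tX.
exact: weakly_homeo_closed_embedding fP gP.
Qed.

(** X contains a closed copy of the Cantor space, since one of its closed
pieces is uncountable. The other map is the inclusion of X, which is not
closed; but X is resolvable, and the odd members of the chain are compact. *)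
Lemma weakly_homeo_cantor :
  fsigma X -> gdelta X -> ~ countable X -> weakly_homeo X [set: Om].
Proof.
move=> fX gX nX; have [S [cS XS]] := fX.
have [n nS] : exists n, ~ countable (S n).
  apply: contrapT => /forallNP h; apply: nX; rewrite XS.
  by apply: is_countable_bigcup => n; exact: (contrapT (h n)).
have [g gP] := closed_uncountable_closed_embedding (cS n) nS.
have gSX x : X (g x) by case: gP => gS _ _ _; rewrite XS; exists n => //;
  exact: gS.
have gT : closed_embedding setT setT g.
  have incl : closed_embedding (S n) setT id by rewrite -[S n]setTI;
    exact: closed_embedding_relclosed.
  exact: closed_embedding_comp gP incl.
have [_ gc _ _] := gT; have [g' g'K g'c] := closed_embedding_inv id gT.
have gcont : continuous g.
  by move=> x V Vx; apply: filterS (gc x Logic.I V Vx) => y Vy; exact: Vy.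
have gcompact (A : set Om) : compact A -> compact (g @` A).
  move=> cA; apply: continuous_compact => //; exact: continuous_subspaceT.
apply: (@Cantor_Bernstein _ _ X setT id g id g') => //.
- exact: id_continuous_on.
- exact: id_continuous_on.
- move=> m; apply: (@resolvableS _ setT) => //.
  elim: m => [|m IH]; first exact: fsigma_gdelta_resolvable.
  by rewrite doubleS /=; exact: resolvable_image gT _ IH.
- move=> m x _; apply: (compact_closed cantor_space_hausdorff).
  elim: m => [|m IH]; first by apply: gcompact; exact: cantor_space_compact.
  by rewrite doubleS /=; exact: gcompact IH.
Qed.

(** Any bijection works, since X is scattered. *)
Lemma weakly_homeo_nat :
  gdelta X -> countable X -> infinite_set X -> weakly_homeo X [set: nat].
Proof.
move=> gX cX iX; have /card_esym/card_set_bijP[g [gX' gi gs]] :=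
  eq_card_nat cX iX.
pose f x := least [set n | g n = x].
have fg x : X x -> g (f x) = x.
  by move=> /gs[n _ gn]; have [] := @leastP [set n | g n = x] n gn.
exists f, g; split.
- by move=> x Xx; split=> //; exact: fg.
- move=> n _; split; first exact: gX'.
  by apply: gi; rewrite ?inE// fg//; exact: gX'.
- move=> D DX D0; have [x [N [Dx xN]]] := countable_gdelta_isolated cX gX DX D0.
  exists x; split=> //; exists (cyl x N); first exact: nbhs_cyl.
  move=> y yD V Vy; apply: (@filterE _ (nbhs y)) => z zD.
  by rewrite (xN z zD) -(xN y yD); exact: nbhs_singleton.
- apply: continuous_on_weakly_disc => n _ V Vn.
  have n1 : nbhs n [set n] by exact: discrete_set1.
  by apply: (filterS _ n1) => m -> _; exact: nbhs_singleton.
Qed.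

End classification.

(** * Embedding a zero-dimensional metrizable space *)

Definition om_embedding (X : topologicalType) (e : X -> Om) : Prop :=
  [/\ continuous e, injective e
    & forall x V, nbhs x V -> exists N, forall y, cyl (e x) N (e y) -> V y].

Lemma om_embedding_weakly_homeo (X : topologicalType) (x0 : X) (e : X -> Om) :
  om_embedding e -> weakly_homeo [set: X] (range e).
Proof.
move=> [ec ei en].
have /exists_choice[r rP] : forall y, exists x, range e y -> e x = y.
  move=> y; have [[x _ <-]|ny] := pselect (range e y); first by exists x.
  by exists x0 => /ny.
have re x : r (e x) = x by apply: ei; apply: rP; exists x.
exists e, r; split.
- by move=> x _; split=> //; exists x.
- by move=> y ye; split=> //; exact: rP.
- exact/continuous_on_weakly_disc/continuous_on_total.
- apply: continuous_on_weakly_disc => _ [x _ <-] V; rewrite re => /en[N NV].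
  by apply/nbhs_cantorP; exists N => y xy [z _ zy]; rewrite -zy re; apply: NV;
    rewrite zy.
Qed.

Section metric.
Local Open Scope ring_scope.
Context {R : realType} {X : topologicalType}.
Variable d : X -> X -> R.
Hypothesis dm : is_metric d.
Hypothesis dg : generates_topology d.

Lemma dist_sym x y : d x y = d y x. Proof. by case: dm. Qed.

Lemma dist_tri x y z : d x z <= d x y + d y z. Proof. by case: dm. Qed.

Lemma dist_refl x : d x x = 0. Proof. by case: dm => _ /(_ x x)[_ ->]. Qed.

Lemma dist_eq x y : d x y = 0 -> x = y. Proof. by case: dm => _ /(_ x y)[]. Qed.

Lemma dist_half x y z e : d y x < e / 2 -> d y z < e / 2 -> d x z < e.
Proof.
move=> yx yz; apply: le_lt_trans (dist_tri x y z) _.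
by rewrite [e]splitr dist_sym ltrD.
Qed.

Lemma dist_ball_open x e : open [set y | d x y < e].
Proof.
apply/dg => y /= xy; exists (e - d x y); first by rewrite subr_gt0.
move=> z /= yz; apply: le_lt_trans (dist_tri x y z) _.
by rewrite -ltrBrDl.
Qed.

Lemma nbhs_distP x V :
  nbhs x V <-> exists2 e : R, 0 < e & [set y | d x y < e] `<=` V.
Proof.
split=> [|[e e0 eV]].
  rewrite nbhsE => -[A [/dg oA Ax] AV]; have [e e0 eA] := oA x Ax.
  by exists e => // y /eA/AV.
apply: filterS eV _; apply: open_nbhs_nbhs; split; first exact: dist_ball_open.
by rewrite /= dist_refl.
Qed.

(** For each point q m of a dense sequence and all n, k choose, if there is
one, a clopen set of diameter below 1/(n+1) that contains the ball of radius
1/(k+1) around q m. These countably many sets form a basis, and the map records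
membership in them. *)
Lemma metric_clopen_embedding (x0 : X) :
  has_clopen_basis X -> separable X -> exists e : X -> Om, om_embedding e.
Proof.
move=> [B [_ Bb] Bc] [D Dc Dd].
have [|q Dq] := countable_range Dc.
  have [|y [_ Dy]] := Dd setT _ openT; first by exists x0.
  by exists y.
pose inv (k : nat) : R := k.+1%:R^-1.
have inv_gt0 k : 0 < inv k by rewrite invr_gt0.
have arch (e : R) : 0 < e -> exists k, inv k < e.
  by move=> /ltr_add_invr[k]; rewrite add0r; exists k.
pose fits (p : nat * nat * nat) (W : set X) :=
  [set y | d (q p.1.1) y < inv p.1.2] `<=` W /\
  forall y z, W y -> W z -> d y z < inv p.2.
have /exists_choice[W WP] : forall p, exists W : set X, clopen W /\
    ((exists2 W', clopen W' & fits p W') -> fits p W).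
  move=> p; have [[W' cW' fW']|nW] := pselect (exists2 W',
    clopen W' & fits p W').
    by exists W'.
  by exists setT; split=> //; exact: clopenT.
pose e (x : X) : Om := fun i =>
  if unpickle i is Some p then `[< W p x >] else false.
have ec : continuous e.
  move=> x V /nbhs_cantorP[N NV]; apply: (@filterS _ _ _ (e @^-1` cyl (e x) N)).
    by move=> y /= /NV.
  elim: N {NV} => [|N IH]; first by apply: filterE => y i.
  have : nbhs x [set y | e y N = e x N].
    rewrite /e; case: unpickle => [p|]; last by apply: filterE.
    have [[oW cW] _] := WP p; have [Wx|Wx] := pselect (W p x).
      have : nbhs x (W p) by exact: open_nbhs_nbhs.
      by apply: filterS => y Wy /=; rewrite !asboolT.
    have : nbhs x (~` W p) by apply: open_nbhs_nbhs; split=> //;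
      exact: closed_openC.
    by apply: filterS => y Wy /=; rewrite !asboolF.
  by apply: filterS2 IH => y yN yx; exact: cylS.
have en x V : nbhs x V -> exists N, forall y, cyl (e x) N (e y) -> V y.
  move=> /nbhs_distP[r r0 rV]; have [n nr] := arch r r0.
  have [U [BU Ux] Ur] : filter_from [set U | B U /\ U x] id
      [set y | d x y < inv n / 2].
    by apply: Bb; apply/nbhs_distP; exists (inv n / 2) => //; exact: divr_gt0.
  have cU := Bc _ BU.
  have /nbhs_distP[s s0 sU] : nbhs x U by apply: open_nbhs_nbhs; split=> //;
    case: cU.
  have [k ks] := arch (s / 2) (divr_gt0 s0 (ltr0Sn _ 1)).
  have [|c [xm]] := Dd [set y | d x y < inv k] _ (dist_ball_open _ _).
    by exists x; rewrite /= dist_refl.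
  rewrite Dq => -[m _ mE]; rewrite -mE /= in xm.
  have ft : fits (m, k, n) U.
    split=> [y /= my|y z Uy Uz].
      apply: sU => /=; apply: (@dist_half _ (q m)); last exact: lt_trans my ks.
      by rewrite dist_sym; exact: lt_trans xm ks.
    by apply: (@dist_half _ x); exact: Ur.
  have [_ /(_ (ex_intro2 _ _ U cU ft)) [Wm Wn]] := WP (m, k, n).
  have Wx : W (m, k, n) x by apply: Wm; rewrite /= dist_sym.
  exists (pickle (m, k, n)).+1 => y /(_ _ (ltnSn _)); rewrite /e pickleK => yx.
  have Wy : W (m, k, n) y by apply/asboolP; rewrite yx; apply/asboolP.
  by apply: rV => /=; exact: (lt_trans (Wn _ _ Wx Wy) nr).
exists e; split=> // x y exy; apply: dist_eq; apply/eqP; rewrite eq_le.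
apply/andP; split; last by case: dm.
rewrite leNgt; apply/negP => xy0.
have [|N NV] := en x [set z | d x z < d x y].
  by apply/nbhs_distP; exists (d x y).
by have := NV y; rewrite exy /= ltxx => h; apply: notF; apply: h.
Qed.

(** The image consists of the points of its closure at which the transported
metric has oscillation zero: a sequence of the image converging to such a point
is a Cauchy sequence. *)
Lemma complete_metric_gdelta (e : X -> Om) : complete_metric d ->
  om_embedding e -> gdelta (range e).
Proof.
move=> dc [ec ei en]; pose inv (k : nat) : R := k.+1%:R^-1.
have arch (r : R) : 0 < r -> exists k, inv k < r.
  by move=> /ltr_add_invr[k]; rewrite add0r; exists k.
pose small n N y := forall a b, cyl y N (e a) -> cyl y N (e b) -> d a b < inv n.
pose T n := closure (range e) `&` [set y | forall N, ~ small n N y].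
rewrite /gdelta; have -> : ~` range e = ~` closure (range e) `|` \bigcup_n T n;
  last first.
  apply: fsigmaU; first by apply: fsigma_open; apply: closed_openC;
    exact: closed_closure.
  apply: fsigma_bigcup => n; apply: fsigma_closed; apply: closedI.
    exact: closed_closure.
  move=> y /closure_cylP yT N sm; have [z zT yz] := yT N.
  by apply: (zT N) => a b za zb; apply: sm; apply: cyl_trans yz _.
rewrite eqEsubset; split=> [y ny|y]; last first.
  move=> [ny [x _ xy]|[n _ [_ nsm]] [x _ xy]].
    by apply: ny; rewrite -xy; apply: subset_closure; exists x.
  have [|N NV] := en x [set z | d x z < inv n / 2].
    by apply/nbhs_distP; exists (inv n / 2) => //; apply: divr_gt0;
      rewrite ?invr_gt0.
  apply: (nsm N) => a b; rewrite -xy => /NV/= xa /NV/= xb.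
  exact: dist_half xa xb.
have [cy|] := pselect (closure (range e) y); last by left.
right; apply: contrapT => nT; apply: ny.
have /exists_choice[N NP] : forall n, exists N, small n N y.
  move=> n; apply: contrapT => /forallNP h; apply: nT; exists n => //.
have /exists_choice[u uP] : forall n, exists x,
    cyl y (maxn n (\max_(i < n.+1) N i)) (e x).
  move=> n; move/closure_cylP: cy => /(_ (maxn n (\max_(i < n.+1) N i))).
  by move=> [_ [x _ <-] yx]; exists x.
have uN n m : (n <= m)%N -> cyl y (N n) (e (u m)).
  move=> nm; apply: cyl_le (uP m); rewrite leq_max; apply/orP; right.
  have nm' : (n < m.+1)%N by [].
  exact: (leq_bigmax (Ordinal nm')).
have [|l lP] := dc u.
  move=> r /arch[n nr]; exists n => i j ni nj; apply: lt_trans nr.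
  by apply: (NP n); exact: uN.
exists l => //; apply: funext => i.
have /nbhs_distP[r r0 rV] : nbhs l (e @^-1` cyl (e l) i.+1).
  by apply: ec; exact: nbhs_cyl.
have [M MP] := lP r r0.
have /(_ i (ltnSn i)) <- : cyl (e l) i.+1 (e (u (maxn M i.+1))).
  by apply: rV => /=; rewrite dist_sym; apply: MP; exact: leq_maxl.
by apply: (uP (maxn M i.+1)); rewrite !leq_max ltnSn orbT.
Qed.

(** Compactness is applied to the finite sequences, directed by inclusion. *)
Lemma compact_net (K : set X) (r : R) : compact K -> 0 < r ->
  exists s : seq X, forall x, K x -> exists2 y, y \in s & d y x < r.
Proof.
move=> /compact_near_coveringP cK r0.
pose F : set_system (seq X) :=
  [set P | exists s0 : seq X, forall s, {subset s0 <= s} -> P s].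
have FF : Filter F.
  split.
  - by exists [::].
  - move=> P Q [s sP] [t tQ]; exists (s ++ t) => w st; split.
      by apply: sP => z zs; apply: st; rewrite mem_cat zs.
    by apply: tQ => z zt; apply: st; rewrite mem_cat zt orbT.
  - by move=> P Q PQ [s sP]; exists s => w /sP/PQ.
have [|s sP] := cK _ F (fun s x => exists2 y, y \in s & d y x < r) FF.
  move=> x Kx; exists ([set y | d x y < r], [set s | x \in s]) => /=.
    split; first by apply/nbhs_distP; exists r.
    by exists [:: x] => s; apply; rewrite inE.
  by move=> [y s] [/= xy xs]; exists x.
by exists s => x Kx; apply: sP.
Qed.

Lemma sigma_compact_separable : sigma_compact X -> separable X.
Proof.
move=> [K cK KX]; pose inv (k : nat) : R := k.+1%:R^-1.
have /exists_choice[s sP] : forall p : nat * nat, exists s : seq X,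
    forall x, K p.1 x -> exists2 y, y \in s & d y x < inv p.2.
  by move=> [n k]; apply: compact_net => //; rewrite invr_gt0.
exists (\bigcup_p [set` s p]).
  apply: bigcup_countable => [|p _]; first exact: countableP.
  exact: finite_set_countable.
move=> V [x Vx] oV; have /nbhs_distP[r r0 rV] : nbhs x V by exact:
  open_nbhs_nbhs.
have [k] := ltr_add_invr r0; rewrite add0r => kr.
have [n _ Kx] : (\bigcup_n K n) x by rewrite KX.
have [y ys yx] := sP (n, k) x Kx; exists y; split; last by exists (n, k).
by apply: rV => /=; rewrite dist_sym; exact: lt_trans yx kr.
Qed.

End metric.

Lemma om_embedding_sub (X : topologicalType) (A : set X) (e : X -> Om) :
  om_embedding e -> om_embedding (fun x : set_type A => e (set_val x)).
Proof.
move=> [ec ei en]; split.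
- move=> x; apply: (@continuous_comp _ _ _ set_val e).
    exact: initial_continuous.
  exact: ec.
- by move=> x y /ei/val_inj.
- move=> x V; rewrite nbhsE => -[_ [[W oW <-] Wx] WV].
  have [|N NW] := en (set_val x) W; first exact: open_nbhs_nbhs.
  by exists N => y /NW Wy; exact: WV.
Qed.

Section borel_class_of_image.
Context {R : realType} {X : topologicalType}.
Variable e : X -> Om.
Hypothesis ee : om_embedding e.

Lemma range_infinite : infinite_set [set: X] -> infinite_set (range e).
Proof.
move=> iX fe; apply: iX; have [_ ei _] := ee.
have -> : [set: X] = e @^-1` range e.
  by rewrite eqEsubset; split=> // x _; exists x.
by apply: finite_preimage fe => x y _ _; exact: ei.
Qed.

Lemma polish_gdelta : polish R X -> gdelta (range e).
Proof. by move=> [_ [d [dm dg dc]]]; exact: (complete_metric_gdelta dm dg dc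
  ee). Qed.

Lemma sigma_compact_fsigma : sigma_compact X -> fsigma (range e).
Proof.
move=> [K cK KX]; have [ec _ _] := ee.
have -> : range e = \bigcup_n (e @` K n) by rewrite -image_bigcup KX.
apply: fsigma_bigcup => n; apply/fsigma_closed.
apply: (compact_closed cantor_space_hausdorff).
by apply: continuous_compact => //; exact: continuous_subspaceT.
Qed.

(** With F n the closed pieces and e F n their images, the complement is taken
inside the union of the closures of the e F n: the image of e is this union
minus the union of the sets (closure of e F n) minus e F n, and these are
F_sigma because e F n is G_delta. *)
Lemma sigma_polish_image : sigma_polish R X -> fsigma_cap_gdelta (range e).
Proof.
move=> [F [cF pF FX]]; have [ec ei en] := ee.
have Fr n : range (fun x : set_type (F n) => e (set_val x)) = e @` F n.
  rewrite eqEsubset; split=> [_ [x _ <-]|_ [x Fx <-]].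
    by exists (set_val x) => //; exact: set_valP.
  by exists (SigSub (mem_set Fx)).
have gF n : gdelta (e @` F n).
  have [_ [d [dm dg dc]]] := pF n; rewrite -Fr.
  exact: (complete_metric_gdelta dm dg dc (om_embedding_sub (F n) ee)).
have Fcl n x : closure (e @` F n) (e x) -> F n x.
  move=> /closure_cylP xcl; apply: cF => V /en[N NV].
  by have [_ [y Fy <-] /NV Vy] := xcl N; exists y.
pose S := \bigcup_n closure (e @` F n).
pose T := \bigcup_n (closure (e @` F n) `&` ~` (e @` F n)).
have -> : range e = S `&` ~` T.
  rewrite eqEsubset; split=> [_ [x _ <-]|y [[n _ Sy] Ty]].
    have [n _ Fx] : (\bigcup_n F n) x by rewrite FX.
    split; first by exists n => //; apply: subset_closure; exists x.
    by move=> [m _ [/Fcl Fm]]; apply; exists x.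
  apply: contrapT => ny; apply: Ty; exists n => //; split=> // -[x _ xy].
  by apply: ny; exists x.
apply: fsigma_cap_gdeltaI.
  by apply: fsigma_bigcup => n; apply: fsigma_closed; exact: closed_closure.
rewrite /gdelta setCK; apply: fsigma_bigcup => n; apply: fsigmaI;
  last exact: gF.
by apply: fsigma_closed; exact: closed_closure.
Qed.

End borel_class_of_image.

Lemma sigma_polish_separable (R : realType) (X : topologicalType) :
  sigma_polish R X -> separable X.
Proof.
move=> [F [cF pF FX]].
have /exists_choice[D DP] : forall n, exists D : set X, countable D /\
    forall V x, open V -> V x -> F n x -> V `&` D !=set0.
  move=> n; have [[D cD dD] _] := pF n; exists (set_val @` D).
  split; first exact: card_le_trans (card_image_le _ _) cD.
  move=> V x oV Vx Fx; have [||y [Vy Dy]] := dD (set_val @^-1` V).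
  - by exists (SigSub (mem_set Fx)).
  - by exists V.
  - by exists (set_val y); split=> //; exists y.
exists (\bigcup_n D n).
  apply: bigcup_countable => [|n _]; first exact: countableP.
  by case: (DP n).
move=> V [x Vx] oV; have [n _ Fx] : (\bigcup_n F n) x by rewrite FX.
have [_ /(_ V x oV Vx Fx) [y [Vy Dy]]] := DP n.
by exists y; split=> //; exists n.
Qed.

(** * The space of rationals *)

(** Compare the parities of the exponents of 2 after clearing denominators. *)
Lemma two_not_square (a b : rat) : (2 * a ^+ 2 = b ^+ 2 -> b = 0)%R.
Proof.
move=> ab; apply/eqP/negPn/negP => b0.
have a0 : a != 0%R.
  by apply: contra_neq b0 => a0; apply/eqP;
    rewrite -sqrf_eq0 -ab a0 expr0n mulr0.
have h : (2 * (numq a * denq b) ^+ 2 = (numq b * denq a) ^+ 2)%R.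
  apply/eqP; rewrite -(eqr_int rat) !(rmorphM, rmorphXn, rmorph_nat)/= !numqE.
  rewrite -[(a * _ * _)%R]mulrA -[(b * _ * _)%R]mulrA [(_ * (denq
    a)%:~R)%R]mulrC.
  by apply/eqP; rewrite -expr2 [in LHS]exprMn [in RHS]exprMn mulrA ab.
have := congr1 (fun z => logn 2 `|z|%N) h.
rewrite /= abszM !abszX lognM ?expn_gt0 ?absz_gt0 ?mulf_neq0 ?numq_eq0
  ?denq_neq0//.
rewrite !lognX => /(congr1 odd).
by rewrite oddD !oddM.
Qed.

Section rationals.
Local Open Scope ring_scope.

(** No distance equals r divided by the square root of 2, so the balls with
this radius are clopen. *)
Lemma rat_clopen_basis : has_clopen_basis rat_space.
Proof.
exists [set U | clopen U]; last by [].
split; first by move=> U [].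
move=> x V /nbhs_ballP[r /= r0 rV].
pose f (y : rat^o) : rat^o := 2 * (y - x) ^+ 2.
have fc : continuous f.
  by move=> y; apply: cvgM; [exact: cvg_cst|apply: cvgM; apply: cvgB;
    [exact: cvg_id|exact: cvg_cst|exact: cvg_id|exact: cvg_cst]].
exists (f @^-1` [set z | z < r ^+ 2]); first split.
- split; first by apply: open_comp => [y _|]; [exact: fc|exact: open_lt].
  have -> : f @^-1` [set z | z < r ^+ 2] = f @^-1` [set z | z <= r ^+ 2].
    rewrite eqEsubset; split=> y; rewrite /=; first exact: ltW.
    rewrite le_eqVlt => /orP[/eqP/two_not_square rE|//].
    by move: r0; rewrite rE ltxx.
  by apply: preimage_closed => [y _|]; [exact: fc|exact: closed_le].
- by rewrite /f/= subrr expr0n mulr0 exprn_gt0.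
- move=> y /= fy; apply: rV; rewrite -ball_normE /=.
  have : `|x - y| ^+ 2 < r ^+ 2.
    apply: le_lt_trans fy; rewrite /f -normrX ger0_norm ?sqr_ge0//.
    rewrite -(opprB y x) sqrrN ler_peMl ?sqr_ge0//; by rewrite ler1n.
  by rewrite ltr_pXn2r// nnegrE// ltW.
Qed.

Lemma rat_metric (R : realType) :
  exists d : rat_space -> rat_space -> R, is_metric d /\ generates_topology d.
Proof.
exists (fun x y : rat => ratr `|x - y|); split; first split.
- by move=> x y; rewrite ler0q.
- move=> x y; split=> [/eqP|->]; last by rewrite subrr normr0 raddf0.
  by rewrite fmorph_eq0 normr_eq0 subr_eq0 => /eqP.
- by move=> x y; rewrite distrC.
- by move=> x y z; rewrite -rmorphD ler_rat; exact: ler_distD.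
- move=> A; split=> [oA x Ax|h].
    have /nbhs_ballP[r /= r0 rA] : nbhs (x : rat^o) A by exact: open_nbhs_nbhs.
    exists (ratr r); first by rewrite ltr0q.
    by move=> y; rewrite /= ltr_rat => xy; apply: rA; rewrite -ball_normE.
  rewrite openE => x /h[r r0 rA]; have [k] := ltr_add_invr r0;
    rewrite add0r => kr.
  apply/nbhs_ballP; exists (k.+1%:R^-1); first by rewrite /= invr_gt0.
  move=> y; rewrite -ball_normE /= => xy; apply: rA => /=; apply: lt_trans kr.
  by rewrite -(ratr_nat R) -fmorphV ltr_rat.
Qed.

End rationals.

(** The image of the rationals in the Cantor space is countable without
isolated points, so it is thick for the class of empty sets. *)
Lemma rat_eventually_true (R : realType) :
  weakly_homeo [set: rat_space] eventually_true.
Proof.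
have [d [dm dg]] := rat_metric R.
have [|e ee] := metric_clopen_embedding dm dg (0%R : rat_space)
  rat_clopen_basis.
  exists setT; first exact: countableP.
  by move=> U [x Ux] _; exists x.
have ce : countable (range e).
  exact: card_le_trans (card_image_le _ _) (countableP _).
apply: weakly_homeo_trans (om_embedding_weakly_homeo (0%R : rat_space) ee) _.
apply: weakly_homeo_rationals => //; exists setT; split; first exact: closedT.
  by exists (e 0%R); split=> //; exists 0%R.
move=> x N; rewrite setIT => -[y [ye xy]]; split=> [h|gx].
  have : (range e `&` cyl x N) y by [].
  by rewrite h.
have cx : countable (range e `&` cyl x N).
  by apply: sub_countable ce; apply: subset_card_le => z [].
have [|z [M [[[q _ qz] xz] zM]]] := @countable_gdelta_isolated _ _ cx gx
  (@subset_refl _ _).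
  by exists y.
have [ec ei _] := ee.
have : nbhs (q : rat^o) (e @^-1` (cyl z (maxn N M))).
  by apply: ec; rewrite qz; exact: nbhs_cyl.
move=> /nbhs_ballP[r /= r0 rq].
pose q' : rat := (q + r / 2)%R.
have rz : cyl z (maxn N M) (e q').
  apply: rq; rewrite -ball_normE /= /q' opprD addNKr normrN gtr0_norm
    ?divr_gt0//.
  by rewrite ltr_pdivrMr// ltr_pMr// ltr1n.
have : (range e `&` cyl x N `&` cyl z M) (e q').
  split; last by apply: cyl_le rz; exact: leq_maxr.
  split; first by exists q'.
  by apply: cyl_trans xz _; apply: cyl_le rz; exact: leq_maxl.
move=> /zM; rewrite -qz => /ei /eqP; rewrite /q' -subr_eq0 addrC addKr.
by rewrite mulf_eq0 invr_eq0 gt_eqF.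
Qed.

(** * Sums, products and the classification *)

(** Only the first coordinate has to be shrunk. *)
Lemma weakly_homeo_setX (X Y U : topologicalType) (A : set X) (B : set Y) :
  weakly_homeo A B -> weakly_homeo (A `*` [set: U]) (B `*` [set: U]).
Proof.
have wdX (V W : topologicalType) (D : set V) (f : V ->
  W) : weakly_disc_on D f ->
    weakly_disc_on (D `*` [set: U]) (fun p => (f p.1, p.2)).
  move=> fw S SD [p0 Sp0].
  have [||_ [[p Sp <-] [N Np fc]]] := fw (fst @` S).
  - by move=> _ [p /SD[Dp _] <-].
  - by exists p0.1, p0.
  exists p; split=> //; exists (N `*` setT).
    by exists (N, setT) => //=; split=> //; exact: filterT.
  apply: pair_continuous_on; last exact: snd_continuous_on.
  apply: (continuous_on_comp (B := fst @` S `&` N) _ (@fst_continuous_on _ _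
    _)) => //.
  by move=> q [Sq [Nq _]]; split=> //; exists q.
move=> [f [g [fg gf fw gw]]].
exists (fun p => (f p.1, p.2)), (fun p => (g p.1, p.2)); split.
- by move=> [x u] [/= /fg[Bx ->] _].
- by move=> [x u] [/= /gf[Bx ->] _].
- exact: wdX.
- exact: wdX.
Qed.

(** The partition of A is resolvable, and that of the sum is even clopen. *)
Lemma weakly_homeo_topsum (X T U : topologicalType) (A P : set X) :
  resolvable_in A P -> P `<=` A -> weakly_homeo (A `\` P) [set: T] ->
    weakly_homeo P [set: U] ->
  weakly_homeo A [set: topsum T U].
Proof.
move=> hP PA [f [f' [f1 f2 fw fw']]] [g [g' [g1 g2 gw gw']]].
pose Y (b : bool) : topologicalType := if b then T else U.
pose r (b : bool) : Y b -> X := if b return Y b -> X then f' else g'.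
have rw b : weakly_disc_on [set: Y b] (r b) by case: b.
exists (fun x => if `[< P x >] then existT Y false (g x) else existT Y true (f
  x)).
exists (fun s : topsum T U => r (projT1 s) (projT2 s)); split.
- move=> x Ax; split=> //; case: asboolP => Px /=; first by case: (g1 x Px).
  by case: (f1 x (conj Ax Px)).
- move=> [[] y] _ /=.
    by have [[Ay /asboolF ->] ->] := f2 y Logic.I.
  have [Py gy] := g2 y Logic.I; split; first exact: PA.
  by rewrite asboolT// gy.
- apply: (weakly_disc_piece (f := existT Y false \o g) (f' :=
    existT Y true \o f)) => //.
    apply: (weakly_disc_comp (B := setT)) => //;
      first by apply: weakly_discS gw => x [].
    exact/continuous_on_weakly_disc/continuous_on_total/(@existT_continuous _
      Y).
  apply: (weakly_disc_comp (B := setT)) => //.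
  exact/continuous_on_weakly_disc/continuous_on_total/(@existT_continuous _ Y).
- move=> D _ [[b y0] Dy0].
  have [//||y [Dy [V Vy rc]]] := rw b (existT Y b @^-1` D).
    by exists y0.
  exists (existT Y b y); split=> //; exists (existT Y b @` V).
    exact: (@existT_nbhs _ Y).
  move=> _ [/[swap] -[z Vz <-] Dz] W Wz; change (nbhs z
    [set w | (D `&` (existT Y b @` V)) (existT Y b w) -> W (r b w)]).
  apply: filterS (rc z (conj Dz Vz) W Wz) => w h [Dw [w' Vw' ww]].
  by apply: h; split=> //; rewrite -(existT_inj2 ww).
Qed.

Lemma weakly_homeo_rat_setX (R : realType) (U : topologicalType) (A : set Om) :
  weakly_homeo A (eventually_true `*` [set: U]) ->
    weakly_homeo A [set: (rat_space * U)%type].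
Proof.
move=> h; apply: weakly_homeo_trans h _; apply: weakly_homeo_sym;
  rewrite -setXTT.
exact/weakly_homeo_setX/rat_eventually_true.
Qed.

Lemma weakly_homeo_rat (R : realType) (A : set Om) :
  weakly_homeo A eventually_true -> weakly_homeo A [set: rat_space].
Proof. by move=> h; apply: weakly_homeo_trans h _;
  exact/weakly_homeo_sym/rat_eventually_true. Qed.

Lemma not_thick_fsigma E : fsigma E -> ~ thick fsigma E.
Proof.
move=> fE [K [cK [x Ex] EK]]; have [|+ _] := EK x 0; first by exists x.
apply; apply: fsigmaI; last exact/fsigma_closed/cyl_closed.
by apply: fsigmaI => //; exact: fsigma_closed.
Qed.

Lemma classify_gdelta E : infinite_set E -> gdelta E ->
  [\/ weakly_homeo E [set: nat], weakly_homeo E [set: Om] | ~ fsigma E /\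
    weakly_homeo E [set: Bs]].
Proof.
move=> iE gE; have [fE|nfE] := pselect (fsigma E); last first.
  by apply: Or33; split=> //; exact: weakly_homeo_baire.
have [cE|ncE] := pselect (countable E); first by apply: Or31;
  exact: weakly_homeo_nat.
by apply: Or32; exact: weakly_homeo_cantor.
Qed.

(** Thickness is tested for the F_sigma sets, then for the countable sets, then
for the empty set. When a test succeeds after a failure, the failed test has
split E into a part that is still thick and a G_delta part, and the class of
the latter decides between the remaining models; when all tests fail, E is a
G_delta set. *)
Lemma classify_fsigma_cap_gdelta (R : realType) E :
  infinite_set E -> fsigma_cap_gdelta E ->
  weakly_homeo E [set: nat] \/ weakly_homeo E [set: Om] \/
    weakly_homeo E [set: rat_space] \/
  weakly_homeo E [set: topsum rat_space Om] \/
  weakly_homeo E [set: (rat_space * Om)%type] \/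
  (~ fsigma E /\ (weakly_homeo E [set: Bs] \/
    weakly_homeo E [set: topsum rat_space Bs] \/
     weakly_homeo E [set: topsum (rat_space * Om)%type Bs] \/
     weakly_homeo E [set: (rat_space * Bs)%type])).
Proof.
move=> iE sE; have [tE|ntE] := pselect (thick fsigma E).
  do 5 right; split; first by move=> /not_thick_fsigma.
  by do 3 right; apply: (@weakly_homeo_rat_setX R);
    exact: weakly_homeo_rationals_baire.
have fC A V : fsigma A -> closed V -> fsigma (A `&` V).
  by move=> fA cV; apply: fsigmaI => //; exact: fsigma_closed.
have cC A V : is_countable A -> closed V -> is_countable (A `&` V).
  by move=> cA _; apply: sub_countable cA; apply: subset_card_le => x [].
have eC A V : is_empty A -> closed V -> is_empty (A `&` V).
  by move=> -> _; exact: set0I.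
have [P []] := decomposition fsigma_bigcup fC fsigma0 ntE.
rewrite setIT => PE fEP gP hP fP.
have [tcE|ntcE] := pselect (thick is_countable E).
  have [fsP|nfP] := pselect (fsigma P).
    do 4 right; left; apply: (@weakly_homeo_rat_setX R);
      apply: weakly_homeo_rationals_cantor => //.
    have -> : E = (E `\` P) `|` P by rewrite setUC setDUK.
    exact: fsigmaU.
  do 5 right; split; first by move=> /fP.
  right; right; left; apply: (weakly_homeo_topsum hP PE);
    last exact: weakly_homeo_baire.
  apply: (@weakly_homeo_rat_setX R); apply: weakly_homeo_rationals_cantor => //.
  exact: thick_setD.
have [Q []] := decomposition is_countable_bigcup cC (countable0 _ :
  is_countable set0) ntcE.
rewrite setIT => QE cEQ gQ hQ fQ.
have [teE|nteE] := pselect (thick is_empty E); last first.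
  have [S []] := decomposition is_empty_bigcup eC (erefl : is_empty set0) nteE.
  rewrite setIT => SE ES gS _ _.
  have gE : gdelta E.
    have -> // : E = S.
      apply/seteqP; split=> // x Ex; apply: contrapT => nS.
      by have : (E `\` S) x by []; rewrite ES.
  have [h|h|[nE h]] := classify_gdelta iE gE; first by left.
    by right; left.
  by do 5 right; split=> //; left.
have EQ : weakly_homeo (E `\` Q) [set: rat_space].
  by apply: (weakly_homeo_rat R); apply: weakly_homeo_rationals => //;
    exact: thick_setD.
have [fsQ|nfQ] := pselect (fsigma Q); last first.
  do 5 right; split; first by move=> /fQ.
  right; left; apply: (weakly_homeo_topsum hQ QE) => //;
    exact: weakly_homeo_baire.
have [cQ|ncQ] := pselect (countable Q); last first.
  do 3 right; left; apply: (weakly_homeo_topsum hQ QE) => //;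
    exact: weakly_homeo_cantor.
do 2 right; left; apply: (weakly_homeo_rat R);
  apply: weakly_homeo_rationals => //.
have -> : E = (E `\` Q) `|` Q by rewrite setUC setDUK.
have -> : (E `\` Q) `|` Q = \bigcup_n (if n is 0 then E `\` Q else Q).
  rewrite eqEsubset; split=> [x [h|h]|x [[|n] _ h]]; by
    [exists 0|exists 1|left|right].
by apply: is_countable_bigcup => -[|n].
Qed.

Theorem theorem5p4 (R : realType) (X : topologicalType)
    (infX : infinite_set [set: X])
    (zdX : has_clopen_basis X)
    (metX : metrizable R X) :
  (polish R X ->
     weakly_homeomorphic X nat \/
     weakly_homeomorphic X cantor_space \/
     weakly_homeomorphic X baire_space) /\
  (sigma_compact X ->
     weakly_homeomorphic X nat \/
     weakly_homeomorphic X cantor_space \/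
     weakly_homeomorphic X rat_space \/
     weakly_homeomorphic X (topsum rat_space cantor_space) \/
     weakly_homeomorphic X (rat_space * cantor_space)%type) /\
  (sigma_polish R X ->
     weakly_homeomorphic X nat \/
     weakly_homeomorphic X cantor_space \/
     weakly_homeomorphic X baire_space \/
     weakly_homeomorphic X rat_space \/
     weakly_homeomorphic X (topsum rat_space cantor_space) \/
     weakly_homeomorphic X (topsum rat_space baire_space) \/
     weakly_homeomorphic X (rat_space * cantor_space)%type \/
     weakly_homeomorphic X
       (topsum (rat_space * cantor_space)%type baire_space) \/
     weakly_homeomorphic X (rat_space * baire_space)%type).
Proof.
have [x0 _] := infinite_setN0 infX; have [d [dm dg]] := metX.
have embed : separable X -> exists2 e : X -> Om, om_embedding e
    & forall Y : topologicalType, weakly_homeo (range e) [set: Y] ->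
      weakly_homeomorphic X Y.
  move=> sX; have [e ee] := metric_clopen_embedding dm dg x0 zdX sX.
  exists e => // Y eY; apply: weakly_homeo_weakly_homeomorphic.
  exact: weakly_homeo_trans (om_embedding_weakly_homeo x0 ee) eY.
split; last split.
- move=> pX; have [e ee eY] := embed (proj1 pX).
  by have [/eY|/eY|[_ /eY]] := classify_gdelta (range_infinite ee infX)
    (polish_gdelta ee pX); tauto.
- move=> scX; have [e ee eY] := embed (sigma_compact_separable dm dg scX).
  have fe := sigma_compact_fsigma ee scX.
  have [/eY|[/eY|[/eY|[/eY|[/eY|[]//]]]]] :=
    classify_fsigma_cap_gdelta R (range_infinite ee infX)
      (fsigma_fsigma_cap_gdelta fe); tauto.
- move=> spX; have [e ee eY] := embed (sigma_polish_separable spX).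
  have [/eY|[/eY|[/eY|[/eY|[/eY|[_ [/eY|[/eY|[/eY|/eY]]]]]]]]] :=
    classify_fsigma_cap_gdelta R (range_infinite ee infX) (sigma_polish_image
      ee spX); tauto.
Qed.
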